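(* Let $u$ be the weak solution of the parabolic problem $\partial_t u-\nabla\cdot(a\nabla u)=f$ in $\Omega\times(0,T]$, $u(0)=u_0$, $u|_{\partial\Omega}=0$, and let $U\in C^{0,1}(0,T;S)$ be the solution of the spatially semidiscrete DG scheme $$\langle\partial_t U,V\rangle+B(U,V)=\langle f,V\rangle\quad\text{for all }V\in S,\ t\in[0,T].$$ Let $w(t)\in H^1_0(\Omega)$ be the elliptic reconstruction of $U(t)$, $t\in[0,T]$. Assume that the DG bilinear form $B$ and the DG norm $|||\cdot|||$ on $\mathcal S=S+H^1_0(\Omega)$ satisfy, for all $t$ and all $v,z\in H^1_0(\Omega)$, $$B(v,z)=\int_\Omega (a(\cdot,t)\nabla v)\cdot\nabla z,\qquad |||v|||=\|\sqrt{a(\cdot,t)}\,\nabla v\|,$$ and that a decomposition $U=U_c+U_d$ with $U_c\in S\cap H^1_0(\Omega)$ and $U_d=U-U_c\in S$ is available. Then $$\|U-u\|_{L_2(0,T;\mathcal S)}\le 3\|w-U\|_{L_2(0,T;\mathcal S)}+2\|U_d\|_{L_2(0,T;\mathcal S)}+2\,\big\|\partial_tU_d/\sqrt{\alpha_\flat}\big\|_{L_2(0,T;H^{-1}(\Omega))}+2\|u_0-U_c(0)\|.$$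
   Context: Setting. $\Omega\subset\mathbb R^d$, $d\in\{2,3\}$, is an open (possibly curvilinear) polygonal domain, $T>0$, $f\in L_\infty(0,T;L_2(\Omega))$ is piecewise continuous in time with finitely many time-discontinuities, and $a\in L_\infty(\Omega\times(0,T))^{d\times d}$ is symmetric positive definite almost everywhere, uniformly elliptic (the infimum and supremum of $(a(x,t)\zeta)\cdot\zeta/|\zeta|^2$ over $\zeta\ne0$ and $(x,t)$ are positive real numbers) and continuous in time, with spatial discontinuities aligned with the mesh. The weak solution $u$ satisfies $u\in C(0,T;H^1_0(\Omega))$, $\partial_tu\in L_2(0,T;L_2(\Omega))$ and $\langle\partial_tu,v\rangle+\int_\Omega (a\nabla u)\cdot\nabla v=\langle f,v\rangle$ for all $v\in H_0^1(\Omega)$. Notation. $\|\cdot\|$ and $\langle\cdot,\cdot\rangle$ are the norm and inner product of $L_2(\Omega)$. For $g\in L_2(\Omega)$, $\|g\|_{H^{-1}(\Omega)}=\sup_{0\ne\phi\in H^1_0(\Omega)}\langle g,\phi\rangle/\|\nabla\phi\|$. Discrete space. $\mathcal T$ is a (time-independent) subdivision of $\Omega$ into disjoint open elements $\kappa$ with diffeomorphisms $F_\kappa:\hat\kappa\to\kappa$, $\hat\kappa$ the reference simplex or cube, and for fixed $p\ge1$, $S=\{v\in L_2(\Omega): v|_\kappa\circ F_\kappa\in\mathcal P_p(\hat\kappa)\ \forall\kappa\in\mathcal T\}$, where $\mathcal P_p$ denotes polynomials of degree $p$ (of degree $p$ in each variable on the cube). For each $t$, $B=B(t;\cdot,\cdot):\mathcal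 S\times\mathcal S\to\mathbb R$ is a bilinear form and $|||\cdot|||$ (also depending on $t$) is a norm on $\mathcal S=S+H_0^1(\Omega)$; the $t$-dependence is suppressed. Define $\|v\|_{L_2(0,T;\mathcal S)}=\big(\int_0^T|||v(t)|||^2\,dt\big)^{1/2}$. $\alpha_\flat(t)=\min_{\kappa\in\mathcal T}\big\|\,|(\sqrt{a}(\cdot,t))^{-1}|_2\,\big\|_{L^\infty(\kappa)}^{-2}$, where $|\cdot|_2$ is the Euclidean-induced matrix norm. Elliptic reconstruction. Let $\Pi:L_2(\Omega)\to S$ be the $L_2$-orthogonal projection and, for each $t$, $A:S\to S$ the operator defined by $\langle AZ,V\rangle=B(Z,V)$ for all $V\in S$. The elliptic reconstruction $w(t)\in H^1_0(\Omega)$ of $U(t)$ is the solution of $B(w,v)=\langle AU-\Pi f+f,v\rangle$ for all $v\in H^1_0(\Omega)$. Decomposition. No particular choice of the conforming part $U_c$ and nonconforming part $U_d$ is specified. *)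

(* Defs.v *)
From HB Require Import structures.
From mathcomp Require Import all_boot all_order all_algebra.
From mathcomp Require Import all_classical all_reals all_analysis.
From mathcomp Require Import measurable_realfun.
Set Implicit Arguments.
Unset Strict Implicit.
Unset Printing Implicit Defensive.
Import Order.TTheory GRing.Theory Num.Theory.
Import numFieldNormedType.Exports.
Local Open Scope classical_set_scope.
Local Open Scope ring_scope.

Definition rV_display : measure_display.
Proof. exact: default_measure_display. Qed.

Section borel_rV.
Variables (R : realType) (n : nat).
Let rVopen : set (set 'rV[R]_n) := [set U | open U].

HB.instance Definition _ := @isMeasurable.Build rV_display 'rV[R]_n
  <<s rVopen >> (@sigma_algebra0 _ setT rVopen) (@sigma_algebraC _ rVopen)
  (@sigma_algebra_bigcup _ setT rVopen).
End borel_rV.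

Section lebesgue_rV.
Context {R : realType}.

Definition rbox n (q r : 'rV[R]_n) : set 'rV[R]_n :=
  [set x | forall i, q 0 i < x 0 i < r 0 i].

Lemma open_rV_bigcup n (U : set 'rV[R]_n) : open U ->
  U = \bigcup_(p in [set p : 'rV[rat]_n * 'rV[rat]_n |
         rbox (map_mx ratr p.1) (map_mx ratr p.2) `<=` U])
      rbox (map_mx ratr p.1) (map_mx ratr p.2).
Proof.
move=> oU; apply/seteqP; split=> [x Ux|x [p /= pU xp]]; last exact: pU.
have /nbhs_ballP[e /= e0 xeU] := open_nbhs_nbhs (conj oU Ux).
have /all_sig[q qP] i : {q : rat | x 0 i - e < ratr q < x 0 i}.
  apply: cid; have /rat_in_itvoo[q] : x 0 i - e < x 0 i by rewrite ltrBlDr ltrDl.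
  by rewrite in_itv/= => h; exists q.
have /all_sig[r rP] i : {r : rat | x 0 i < ratr r < x 0 i + e}.
  apply: cid; have /rat_in_itvoo[q'] : x 0 i < x 0 i + e by rewrite ltrDl.
  by rewrite in_itv/= => h; exists q'.
exists (\row_i q i, \row_i r i) => /=; last first.
  by move=> i; rewrite !mxE; case/andP: (qP i) => _ ->; case/andP: (rP i).
move=> y yB; apply: xeU; split=> // i j; rewrite (ord1 i).
have := yB j; rewrite !mxE => /andP[y1 y2].
have /andP[q1 _] := qP j; have /andP[_ r2] := rP j.
rewrite /ball/= ltr_distlC; apply/andP; split.
  by rewrite (lt_trans q1).
by rewrite (lt_trans y2).
Qed.

Lemma measurable_preimage_rbox d (T : measurableType d) n (f : T -> 'rV[R]_n)
    (q r : 'rV[R]_n) :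
  (forall i, measurable_fun setT (fun p => f p 0 i)) ->
  measurable (f @^-1` rbox q r).
Proof.
move=> mf; rewrite (_ : _ @^-1` _ = \big[setI/setT]_(i < n)
    ((fun t => f t 0 i) @^-1` `]q 0 i, r 0 i[)); last first.
  rewrite -bigcap_seq; apply/seteqP; split => t /= h i.
    by move=> _; rewrite /= in_itv/=; exact: h.
  by have := h i (mem_index_enum i); rewrite /= in_itv.
apply: bigsetI_measurable => i _; rewrite -[X in measurable X]setTI.
exact: mf.
Qed.

Lemma measurable_fun_rV d (T : measurableType d) n (f : T -> 'rV[R]_n) :
  (forall i, measurable_fun setT (fun p => f p 0 i)) -> measurable_fun setT f.
Proof.
move=> mf.
apply: (@measurability _ _ _ _ _ f [set U : set 'rV[R]_n | open U]) => //.
move=> _ [U oU <-]; rewrite setTI (open_rV_bigcup oU) preimage_bigcup.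
rewrite bigcup_mkcond; apply: countable_bigcupT_measurable => // p.
by case: ifPn => // _; exact: measurable_preimage_rbox.
Qed.

Lemma measurable_rV_coord n i : measurable_fun setT (fun x : 'rV[R]_n => x 0 i).
Proof.
apply: (measurability _ (RGenOInfty.measurableE R)).
move=> _ [_ [a ->] <-]; rewrite setTI; apply: sub_sigma_algebra.
have : open `]a, +oo[%classic by exact: rray_open.
by apply: open_comp => x _; exact: coord_continuous.
Qed.

Definition rV_cons n (p : measurableTypeR R * 'rV[R]_n) : 'rV[R]_n.+1 :=
  \row_i (if unlift ord0 i is Some j then p.2 0 j else p.1).

Definition rV_uncons n (x : 'rV[R]_n.+1) : measurableTypeR R * 'rV[R]_n :=
  (x 0 ord0, \row_j x 0 (lift ord0 j)).

Lemma rV_unconsK n : cancel (@rV_uncons n) (@rV_cons n).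
Proof.
move=> x; apply/rowP => i; rewrite mxE; case: unliftP => [j|] ->//=.
by rewrite mxE.
Qed.

Lemma rV_consK n : cancel (@rV_cons n) (@rV_uncons n).
Proof.
move=> [a x]; rewrite /rV_uncons mxE unlift_none; congr (_, _).
by apply/rowP => j; rewrite !mxE liftK.
Qed.

Lemma measurable_rV_cons n : measurable_fun setT (@rV_cons n).
Proof.
apply: measurable_fun_rV => i; under eq_fun do rewrite mxE.
case: unliftP => [j|] _; last exact: measurable_fst.
exact: measurableT_comp (measurable_rV_coord j) measurable_snd.
Qed.

Lemma measurable_rV_uncons n : measurable_fun setT (@rV_uncons n).
Proof.
apply: measurable_fun_pair; first exact: measurable_rV_coord.
apply: measurable_fun_rV => i; under eq_fun do rewrite mxE.
exact: measurable_rV_coord.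
Qed.

Section step.
Variables (n : nat) (mu : {sigma_finite_measure set 'rV[R]_n -> \bar R}).

Definition lebesgue_step := pushforward (lebesgue_measure \x mu)%E (@rV_cons n).

Let m : {measure set _ -> \bar R} :=
  measure_function_pushforward__canonical__measure_function_Measure
    (lebesgue_measure \x mu)%E (@measurable_rV_cons n).

HB.instance Definition _ := isMeasure.Build _ _ _ lebesgue_step
  (@measure0 _ _ _ m) (measure_ge0 m) (@measure_semi_sigma_additive _ _ _ m).

Let sf : sigma_finite setT lebesgue_step.
Proof.
have /sigma_finiteP[F [FT ndF mF]] := sigma_finiteT (@lebesgue_measure R).
have /sigma_finiteP[G [GT ndG mG]] := sigma_finiteT mu.
exists (fun k => @rV_uncons n @^-1` (F k `*` G k)).
  rewrite -preimage_bigcup (_ : \bigcup_k _ = setT) ?preimage_setT//.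
  apply/seteqP; split => // -[x y] _.
  have [i _ Fx] : (\bigcup_k F k) x by rewrite -FT.
  have [j _ Gy] : (\bigcup_k G k) y by rewrite -GT.
  exists (maxn i j) => //; split.
  - by move: x Fx; exact/subsetPset/ndF/leq_maxl.
  - by move: y Gy; exact/subsetPset/ndG/leq_maxr.
move=> k; have [mFk Fk] := mF k; have [mGk Gk] := mG k; split.
  rewrite -[X in measurable X]setTI; apply: measurable_rV_uncons => //.
  exact: measurableX.
rewrite /lebesgue_step /pushforward -comp_preimage.
rewrite (_ : _ \o _ = id); last by apply/funext => p /=; rewrite rV_consK.
by rewrite product_measure1E// lte_mul_pinfty// ge0_fin_numE.
Qed.

HB.instance Definition _ := Measure_isSigmaFinite.Build _ _ _ lebesgue_step sf.
End step.

(* The d-dimensional Lebesgue measure on the Borel sets of 'rV[R]_d: the iterated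
   product of the one-dimensional one (a unit mass in dimension 0); its value on
   boxes is lebesgue_rV_box below. *)
Fixpoint lebesgue_rV n : {sigma_finite_measure set 'rV[R]_n -> \bar R} :=
  if n is m.+1 then lebesgue_step (lebesgue_rV m) else \d_(0 : 'rV[R]_0).

Lemma measurable_rbox n (q r : 'rV[R]_n) : measurable (rbox q r).
Proof.
by apply: (@measurable_preimage_rbox _ _ _ idfun) => i; exact: measurable_rV_coord.
Qed.

Lemma lebesgue_rV_box n (q r : 'rV[R]_n) : (forall i, q 0 i <= r 0 i) ->
  lebesgue_rV n (rbox q r) = (\prod_i (r 0 i - q 0 i))%:E.
Proof.
elim: n q r => [|n IH] q r qr.
  by rewrite big_ord0 /= diracE mem_set// => -[].
rewrite big_ord_recl/= /lebesgue_step /pushforward.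
pose q' := (rV_uncons q).2; pose r' := (rV_uncons r).2.
rewrite (_ : _ @^-1` _ = `]q 0 0, r 0 0[%classic `*` rbox q' r'); last first.
  apply/seteqP; split => -[a x] /=.
    move=> h; split; first by have := h ord0; rewrite mxE unlift_none in_itv.
    by move=> i; have := h (lift ord0 i); rewrite !mxE liftK.
  rewrite in_itv/= => -[ha hx] i; rewrite mxE; case: unliftP => [j|] ->//.
  by have := hx j; rewrite !mxE.
rewrite product_measure1E//; last exact: measurable_rbox.
rewrite IH; last by move=> i; rewrite !mxE.
rewrite (eq_bigr (fun i => r 0 (lift ord0 i) - q 0 (lift ord0 i))); last first.
  by move=> i _; rewrite !mxE.
rewrite [X in (X * _)%E](_ : _ = (r 0 ord0 - q 0 ord0)%:E) ?EFinM//.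
rewrite [LHS](lebesgue_measure_itv `]q 0 0, r 0 0[)/= lte_fin.
case: ltP => // h.
by have /eqP -> : r 0 ord0 == q 0 ord0 by [rewrite eq_le h qr]; rewrite subrr.
Qed.
End lebesgue_rV.

Section linear_algebra.
Context {R : realType} {d : nat}.
Implicit Types (M Q : 'M[R]_d) (y z : 'cV[R]_d).

Definition dotv y z : R := \sum_i y i 0 * z i 0.

Definition enorm z : R := Num.sqrt (dotv z z).

Definition opnorm M : R :=
  sup [set enorm (M *m z) / enorm z | z in [set z | z != 0]].

Definition symposdef M := M^T = M /\ forall z, z != 0 -> 0 < dotv (M *m z) z.

(* The positive semidefinite square root is unique when it exists, which is the
   case for every symmetric positive definite M. *)
Definition sqrtm M : 'M[R]_d :=
  xget 0 [set Q | [/\ Q^T = Q, (forall z, 0 <= dotv (Q *m z) z) & Q *m Q = M]].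

End linear_algebra.

Section spaces.
Context {R : realType} {d : nat}.
Variable Om : set 'rV[R]_d.
Local Notation E := 'rV[R]_d.
Local Notation mu := (@lebesgue_rV R d).
Implicit Types (v z phi : E -> R) (G : E -> 'cV[R]_d).

(* Elements of L_2(Om) are represented by functions; only their restriction to
   Om matters, and two representatives of the same element are related by
   ae_eq_on. *)
Definition ae_eq_on v z := {ae mu, forall x, Om x -> v x = z x}.

Definition L2 v := measurable_fun Om v /\
  (\int[mu]_(x in Om) ((v x) ^+ 2)%:E < +oo)%E.

Definition inner v z : R := \int[mu]_(x in Om) (v x * z x).

Definition L2norm v : R := Num.sqrt (inner v v).

Definition L2vec G := forall i, L2 (fun x => G x i 0).

Definition L2vnorm G : R := Num.sqrt (\int[mu]_(x in Om) dotv (G x) (G x)).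

Definition partial (i : 'I_d) phi : E -> R := fun x => 'D_(delta_mx 0 i) phi x.

Definition cgrad phi : E -> 'cV[R]_d := fun x => \col_i partial i phi x.

Fixpoint Ck (k : nat) phi : Prop :=
  continuous phi /\
  if k is k'.+1 then
    forall i, (forall x, derivable phi x (delta_mx 0 i)) /\ Ck k' (partial i phi)
  else True.

(* C_c^oo(Om) *)
Definition test_function phi := (forall k, Ck k phi) /\
  exists K : set E, [/\ compact K, K `<=` Om & forall x, ~ K x -> phi x = 0].

Definition weak_gradient v G := L2vec G /\
  forall phi i, test_function phi ->
    inner v (partial i phi) = - inner (fun x => G x i 0) phi.

Definition grad v : E -> 'cV[R]_d := xget (fun=> 0) [set G | weak_gradient v G].

(* H^1_0(Om), the closure of C_c^oo(Om) in H^1(Om) *)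
Definition H10 v := L2 v /\
  exists2 G, weak_gradient v G &
    forall e, 0 < e -> exists phi,
      [/\ test_function phi, L2norm (v \- phi) < e &
          L2vnorm (fun x => G x - cgrad phi x) < e].

Definition H1norm v : R := Num.sqrt (L2norm v ^+ 2 + L2vnorm (grad v) ^+ 2).

Definition Hm1norm v : \bar R :=
  ereal_sup [set (inner v phi / L2vnorm (grad phi))%:E |
             phi in [set phi | H10 phi /\ ~ ae_eq_on phi (fun=> 0)]].

End spaces.

Section time_dependent.
Context {R : realType} {d : nat}.
Variables (Om : set 'rV[R]_d) (T : R).
Local Notation E := 'rV[R]_d.
Local Notation mu := (@lebesgue_rV R d).
Local Notation lam := (@lebesgue_measure R).
Implicit Types (v g : R -> E -> R) (n : R -> \bar R).

Definition spacetime : set (measurableTypeR R * E) := `[0, T]%classic `*` Om.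

Definition time_continuous_at (nrm : (E -> R) -> R) v (t : R) :=
  forall e, 0 < e -> exists2 del, 0 < del &
    forall s : R, s \in `[0, T] -> `|s - t| < del -> nrm (v s \- v t) < e.

(* The L_2(0,T)-norm of t |-> n t; it is +oo when n is not square integrable. *)
Definition L2time n : \bar R :=
  ((\int[lam]_(t in `[0%R, T]) (n t ^+ 2)) `^ 2^-1)%E.

Definition time_measurable n :=
  measurable_fun (`[0, T]%classic : set (measurableTypeR R)) n.

(* L_2(0,T;L_2(Om)), by representatives that are measurable in (t,x) *)
Definition L2L2 g :=
  [/\ (forall t : R, t \in `[0, T] -> L2 Om (g t)),
      measurable_fun spacetime (fun p => g p.1 p.2) &
      (\int[lam \x mu]_(p in spacetime) ((g p.1 p.2) ^+ 2)%:E < +oo)%E].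

(* C^1_c(0,T) *)
Definition time_test (th : R -> R) :=
  [/\ (forall t, derivable th t 1), continuous (derive1 th) &
      exists b c, [/\ 0 < b, c < T & forall t : R, t \notin `[b, c] -> th t = 0]].

(* g is the weak derivative in L_2(0,T;L_2(Om)) of v: the identity
   \int v th' dt = - \int g th dt in L_2(Om), tested against every z in L_2(Om).
   For v Lipschitz in time with values in a finite-dimensional subspace, g is the
   derivative of v almost everywhere. *)
Definition time_derivative v g := L2L2 g /\
  forall th z, time_test th -> L2 Om z ->
    \int[lam]_(t in `[0, T]) (inner Om (v t) z * derive1 th t) =
    - \int[lam]_(t in `[0, T]) (inner Om (g t) z * th t).

End time_dependent.

Section meshes.
Context {R : realType} {d : nat}.
Local Notation E := 'rV[R]_d.
Local Notation mu := (@lebesgue_rV R d).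
Variable Om : set E.

Definition C1_on (A : set E) (F : E -> E) :=
  forall x, A x -> differentiable F x /\ forall y, {for x, continuous ('D_y F)}.

Definition diffeo (A : set E) (F : E -> E) (B : set E) :=
  [/\ open A, open B, F @` A = B, C1_on A F &
      exists G, (forall x, A x -> G (F x) = x) /\ C1_on B G].

(* the unit simplex when b, the unit cube otherwise *)
Definition ref_element (b : bool) : set E :=
  if b then [set x | (forall i, 0 < x 0 i) /\ \sum_i x 0 i < 1]
  else [set x | forall i, 0 < x 0 i < 1].

(* A bounded domain whose closure is a finite union of images of the closed unit
   simplex under diffeomorphisms defined in a neighbourhood of it. *)
Definition curvilinear_polygonal_domain :=
  [/\ open Om, connected Om, Om !=set0, bounded_set Om &
      exists (n : nat) (F : 'I_n -> E -> E),
        closure Om = \bigcup_j F j @` closure (ref_element true) /\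
        forall j, exists A : set E, closure (ref_element true) `<=` A /\
          diffeo A (F j) (F j @` A)].

(* Polynomials of total degree at most p when b, of degree at most p in each
   variable otherwise. *)
Definition Ppoly (b : bool) (p : nat) : set (E -> R) :=
  [set q | exists2 c : {ffun 'I_d -> 'I_p.+1} -> R,
     (b -> forall k : {ffun 'I_d -> 'I_p.+1}, (p < \sum_i k i)%N -> c k = 0) &
     q = fun x : E => \sum_k c k * \prod_i x 0 i ^+ k i].

Section mesh.
Variables (K : finType) (kap : K -> set E) (sh : K -> bool) (F : K -> E -> E).

Definition subdivision :=
  [/\ (forall k, kap k `<=` Om),
      (forall k l, k != l -> kap k `&` kap l = set0),
      mu.-negligible (Om `\` \bigcup_k kap k) &
      forall k, diffeo (ref_element (sh k)) (F k) (kap k)].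

Variable p : nat.

Definition DGspace (v : E -> R) := L2 Om v /\
  forall k, exists2 q, Ppoly (sh k) p q &
    {ae mu, forall x, ref_element (sh k) x -> v (F k x) = q x}.

Definition DGsum (v : E -> R) := exists s h, [/\ DGspace s, H10 Om h & v = s \+ h].

Definition is_L2_projection (P : (E -> R) -> E -> R) :=
  forall g, L2 Om g -> DGspace (P g) /\
    forall V, DGspace V -> inner Om (P g) V = inner Om g V.

Definition is_discrete_operator (b : (E -> R) -> (E -> R) -> R)
    (A : (E -> R) -> E -> R) :=
  forall Z, DGspace Z -> DGspace (A Z) /\
    forall V, DGspace V -> inner Om (A Z) V = b Z V.

End mesh.

(* Bilinear forms and norms on a space X of elements of L_2(Om), X being given by
   its representatives. *)
Definition bilinear_form_on (X : (E -> R) -> Prop) (b : (E -> R) -> (E -> R) -> R) :=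
  [/\ (forall v v' z z', X v -> X v' -> X z -> X z' ->
         ae_eq_on Om v v' -> ae_eq_on Om z z' -> b v z = b v' z'),
      (forall c v v' z, X v -> X v' -> X z ->
         b (c \*o v \+ v') z = c * b v z + b v' z) &
      (forall c v z z', X v -> X z -> X z' ->
         b v (c \*o z \+ z') = c * b v z + b v z')].

Definition norm_on (X : (E -> R) -> Prop) (nrm : (E -> R) -> R) :=
  [/\ (forall v, X v -> 0 <= nrm v),
      (forall v, X v -> nrm v = 0 <-> ae_eq_on Om v (fun=> 0)),
      (forall c v, X v -> nrm (c \*o v) = `|c| * nrm v) &
      (forall v z, X v -> X z -> nrm (v \+ z) <= nrm v + nrm z)].

End meshes.

Section parabolic_problem.
Context {R : realType} {d : nat}.
Local Notation E := 'rV[R]_d.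
Local Notation mu := (@lebesgue_rV R d).
Local Notation lam := (@lebesgue_measure R).
Variables (Om : set E) (T : R).

Definition stiffness (a : E -> 'M[R]_d) (v z : E -> R) : R :=
  \int[mu]_(x in Om) dotv (a x *m grad Om v x) (grad Om z x).

Definition energy_norm (a : E -> 'M[R]_d) (v : E -> R) : R :=
  L2vnorm Om (fun x => sqrtm (a x) *m grad Om v x).

Definition diffusion_coefficient (K : finType) (kap : K -> set E)
    (a : R -> E -> 'M[R]_d) :=
  [/\ (forall i j, measurable_fun (spacetime Om T) (fun p => a p.1 p.2 i j)),
      (exists M : R, {ae (lam \x mu)%E, forall p, spacetime Om T p ->
         forall i j, `|a p.1 p.2 i j| <= M}),
      {ae (lam \x mu)%E, forall p, spacetime Om T p -> symposdef (a p.1 p.2)},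
      (exists c C : R, 0 < c /\ {ae (lam \x mu)%E, forall p, spacetime Om T p ->
         forall z, c * dotv z z <= dotv (a p.1 p.2 *m z) z <= C * dotv z z}) &
      {ae mu, forall x, Om x -> {within `[0, T], continuous (a ^~ x)}} /\
      (forall (t : R) k, t \in `[0, T] -> {within kap k, continuous (a t)})].

(* L_oo(0,T;L_2(Om)), continuous in time up to finitely many instants *)
Definition source_term (f : R -> E -> R) :=
  [/\ (forall t : R, t \in `[0, T] -> L2 Om (f t)),
      measurable_fun (spacetime Om T) (fun p => f p.1 p.2),
      (exists M : R, {ae lam, forall t : R, t \in `[0, T] -> L2norm Om (f t) <= M}) &
      exists D : seq R, forall t : R, t \in `[0, T] -> t \notin D ->
        time_continuous_at T (L2norm Om) f t].

Definition weak_solution (a : R -> E -> 'M[R]_d) (f : R -> E -> R) (u0 : E -> R)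
    (u du : R -> E -> R) :=
  [/\ (forall t : R, t \in `[0, T] ->
         H10 Om (u t) /\ time_continuous_at T (H1norm Om) u t),
      time_derivative Om T u du,
      {ae lam, forall t : R, t \in `[0, T] -> forall v, H10 Om v ->
         inner Om (du t) v + stiffness (a t) (u t) v = inner Om (f t) v} &
      ae_eq_on Om (u 0) u0].

(* U in C^{0,1}(0,T;X) with X a finite-dimensional space of elements of L_2(Om),
   all norms on X being equivalent, solves the Galerkin scheme in X. *)
Definition semidiscrete_solution (X : (E -> R) -> Prop)
    (B : R -> (E -> R) -> (E -> R) -> R) (f U dU : R -> E -> R) :=
  [/\ (forall t : R, t \in `[0, T] -> X (U t) /\ X (dU t)),
      (exists L : R, forall s t : R, s \in `[0, T] -> t \in `[0, T] ->
         L2norm Om (U s \- U t) <= L * `|s - t|),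
      time_derivative Om T U dU &
      forall t : R, t \in `[0, T] -> forall V, X V ->
        inner Om (dU t) V + B t (U t) V = inner Om (f t) V].

Definition elliptic_reconstruction (B : R -> (E -> R) -> (E -> R) -> R)
    (P : (E -> R) -> E -> R) (A : R -> (E -> R) -> E -> R) (f U w : R -> E -> R) :=
  forall t : R, t \in `[0, T] -> H10 Om (w t) /\
    forall v, H10 Om v ->
      B t (w t) v = inner Om (A t (U t) \- P (f t) \+ f t) v.

(* min over k of || |sqrt(a)^-1|_2 ||_{L_oo(kap k)}^-2 *)
Definition alpha_flat (K : finType) (kap : K -> set E) (a : E -> 'M[R]_d) : R :=
  inf [set (fine ('N[mu]_+oo[
              EFin \o ((fun x => opnorm (invmx (sqrtm (a x)))) \_ (kap k))])) ^- 2
      | k in [set: K]].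

End parabolic_problem.

(* Main.v *)
(* Write E = |||Uc - u|||, W = |||w - U|||, D = |||Ud||| and H for the H^-1 norm
   of d_t Ud / sqrt(alpha). The scheme says d_t U + A U = Pi f, so the elliptic
   reconstruction satisfies B(w, v) = <f - d_t U, v> for all v in H^1_0; subtracting
   the weak form of the equation and testing with e = Uc - u gives
     E^2 = - <d_t e, e> - <d_t Ud, e> - B(w - Uc, e) <= - <d_t e, e> + (H + W + D) E,
   hence E^2 <= (H + W + D)^2 - 2 <d_t e, e>. Integrating in time with
   2 \int <d_t e, e> = ||e(T)||^2 - ||e(0)||^2 and using |||U - u||| <= D + E yields
   the bound, even with the weights 1, 2, 1, 1.
   Weak gradients enter only through the forms: linearity of the stiffness form and
   definiteness of the energy norm on H^1_0 are those of B and |||.|||, so neither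
   uniqueness of weak gradients nor Poincare's inequality is needed. *)

Require Import Defs.
From HB Require Import structures.
From mathcomp Require Import all_boot all_order all_algebra.
From mathcomp Require Import all_classical all_reals all_analysis.
From mathcomp Require Import measurable_realfun ess_sup_inf.
From mathcomp Require Import complex.
From mathcomp Require Import ring lra.
Set Implicit Arguments.
Unset Strict Implicit.
Unset Printing Implicit Defensive.
Import Order.TTheory GRing.Theory Num.Theory.
Import numFieldNormedType.Exports.
Local Open Scope classical_set_scope.
Local Open Scope ring_scope.

(** * Square roots of positive definite matrices *)

(** The obstacle is regularity in time. Derivatives in time are weak and tested against one fixed
    element of L_2 at a time, the error is only known to be continuous from [0, T] to L_2, and its
    norm E is not assumed measurable in t. Two devices answer this. The integral of 2 <d_t e, e> is
    computed by replacing e with averages of its values at neighbouring nodes of a time grid: the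
    resulting sum telescopes exactly on every grid, and dominated convergence removes the grid.
    Before the integration in time, E is replaced by the measurable majorant sqrt(max((H + W + D)^2
    - 2 <d_t e, e>, 0)), whose square has a known integral; the sign of ||e(T)||^2 and Minkowski's
    inequality in time then give the bound. H may be infinite at some times, but once its
    L_2(0,T)-norm is finite, as may be assumed, this happens only on a null set. The error is
    carried as U - Ud - u, since U, Ud and u are the functions that come with time derivatives. *)

Section linear_algebra.
Context {R : realType}.

(** Nodes may repeat, as eigenvalues do. A new node is met by adding a multiple of the product that
    vanishes at all earlier ones. *)
Lemma interpolating_poly (s : seq R) (h : R -> R) :
  exists p : {poly R}, forall x, x \in s -> p.[x] = h x.
Proof.
elim: s => [|y s [p IH]]; first by exists 0.
have [ys|ys] := boolP (y \in s).
  by exists p => x; rewrite inE => /predU1P[->|]; exact: IH.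
pose q := \prod_(z <- s) ('X - z%:P).
have qs z : z \in s -> q.[z] = 0.
  by move=> zs; apply/rootP; rewrite root_prod_XsubC.
have qy : q.[y] != 0 by rewrite -[_ == _]/(root q y) root_prod_XsubC.
exists (p + ((h y - p.[y]) / q.[y])%:P * q) => x.
rewrite inE !hornerE => /predU1P[->|xs]; first by rewrite divfK// addrC subrK.
by rewrite [q.[x]](qs _ xs) mulr0 addr0 IH.
Qed.

Section dot.
Context {d : nat}.
Implicit Types (M Q : 'M[R]_d) (y z : 'cV[R]_d).

Lemma dotvE y z : dotv y z = (y^T *m z) 0 0.
Proof. by rewrite mxE; apply: eq_bigr => i _; rewrite mxE. Qed.

Lemma dotvC y z : dotv y z = dotv z y.
Proof. by apply: eq_bigr => i _; rewrite mulrC. Qed.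

Lemma dotvv_ge0 z : 0 <= dotv z z.
Proof. by apply: sumr_ge0 => i _; rewrite -expr2 sqr_ge0. Qed.

Lemma dotvv_eq0 z : (dotv z z == 0) = (z == 0).
Proof.
apply/eqP/eqP => [|->]; last by rewrite /dotv big1// => i _; rewrite mxE mul0r.
move/eqP; rewrite psumr_eq0; last by move=> i _; rewrite -expr2 sqr_ge0.
move/allP => z0; apply/colP => i; rewrite mxE.
by have /eqP := z0 i (mem_index_enum i); rewrite -expr2 => /eqP; rewrite sqrf_eq0 => /eqP.
Qed.

Lemma dotvv_gt0 z : z != 0 -> 0 < dotv z z.
Proof. by move=> z0; rewrite lt_def dotvv_eq0 z0 dotvv_ge0. Qed.

Lemma dotv_mulmxl M y z : dotv (M *m y) z = dotv y (M^T *m z).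
Proof. by rewrite !dotvE trmx_mul mulmxA. Qed.

End dot.

Lemma symmetric_horner d (M : 'M[R]_d.+1) (q : {poly R}) :
  M^T = M -> (horner_mx M q)^T = horner_mx M q.
Proof.
move=> sM; elim/poly_ind: q => [|q c IH]; first by rewrite rmorph0 trmx0.
rewrite rmorphD rmorphM/= horner_mx_X horner_mx_C linearD/= tr_scalar_mx.
congr (_ + _); rewrite -mulmxE trmx_mul IH sM mulmxE.
by have := comm_mx_horner q (comm_mx_refl M); rewrite /comm_mx mulmxE.
Qed.

(** The complexification of M is Hermitian, hence unitarily diagonalizable with real eigenvalues.
    These are then eigenvalues of M over R, and a real eigenvector shows their positivity. *)
Lemma symposdef_spectrum d (M : 'M[R]_d.+1) : symposdef M ->
  exists P D, [/\ P \in unitmx, map_mx (real_complex R) M =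
      invmx P *m diag_mx (map_mx (real_complex R) D) *m P &
    forall i, 0 < D 0 i].
Proof.
move=> [sM pM]; set MC := map_mx _ M.
have hM : MC \is hermsymmx.
  apply/is_hermitianmxP; rewrite expr0 scale1r.
  rewrite /MC map_trmx -map_mx_comp; apply/matrixP => i j; rewrite !mxE/=.
  by rewrite -{1}sM mxE; apply/eqP; rewrite eq_complex/= oppr0 !eqxx.
have /orthomx_spectralP ME := hermitian_normalmx hM.
have rM := hermitian_spectral_diag_real hM.
have PU := spectral_unit MC.
move: (spectralmx MC) (spectral_diag MC) ME rM PU => P sp ME rM PU.
pose D := map_mx (@complex.Re R) sp.
have spE : sp = map_mx (real_complex R) D.
  apply/rowP => i; rewrite !mxE RRe_real//.
  by move/mxOverP : rM; exact.
exists P, D; split; [by []|by rewrite -spE|move=> i].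
have PM : P *m MC = diag_mx sp *m P by rewrite ME -mulmxA mulKVmx.
(* Row i of P is a left eigenvector, nonzero because P is invertible. *)
have : eigenvalue MC (sp 0 i).
  apply/eigenvalueP; exists (row i P).
    rewrite -row_mul PM; apply/rowP => j; rewrite !mxE (bigD1 i)//= mxE eqxx.
    by rewrite mulr1n big1 ?addr0// => k ki; rewrite !mxE eq_sym (negbTE ki) mul0r.
  apply: contraTneq PU => Pi0; rewrite -row_free_unit.
  apply/negP => /row_freeP[Q PQ]; have := congr1 (row i) PQ.
  rewrite row_mul Pi0 mul0mx row1 => /rowP/(_ i); rewrite !mxE !eqxx => /eqP.
  by rewrite eq_sym oner_eq0.
rewrite spE mxE eigenvalue_map => /eigenvalueP[v vM v0].
have vT0 : v^T != 0 by rewrite -trmx0 (inj_eq trmx_inj).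
have := pM _ vT0; rewrite -{1}sM -trmx_mul vM linearZ/=.
rewrite (_ : dotv _ _ = D 0 i * dotv v^T v^T); last first.
  by rewrite /dotv mulr_sumr; apply: eq_bigr => j _; rewrite !mxE mulrA.
by rewrite pmulr_lgt0// dotvv_gt0.
Qed.

(* The root is q(M) ^+ 2, where q is a real polynomial with q(l) = l^(1/4) at the
   eigenvalues l of M: a real symmetric matrix, and a square of one. *)
Lemma symposdef_sqrtm d (M : 'M[R]_d) : (0 < d)%N -> symposdef M ->
  (sqrtm M)^T = sqrtm M /\ sqrtm M *m sqrtm M = M.
Proof.
case: d M => // d M _ pM; have [sM _] := pM.
have [P [D [PU ME D0]]] := symposdef_spectrum pM.
have [q qE] := interpolating_poly [seq D 0 i | i : 'I_d.+1]
  (fun x => Num.sqrt (Num.sqrt x)).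
have q4 : horner_mx M (q ^+ 4) = M.
  suff : map_mx (real_complex R) (horner_mx M (q ^+ 4)) = map_mx (real_complex R) M.
    by move/matrixP => h; apply/matrixP => i j; have := h i j; rewrite !mxE => /complexI.
  rewrite map_horner_mx ME horner_mx_uconjC// horner_mx_diag.
  suff -> : map_mx (horner (map_poly (real_complex R) (q ^+ 4)))
      (map_mx (real_complex R) D) = map_mx (real_complex R) D by [].
  apply/rowP => i; rewrite !mxE horner_map/= horner_exp qE; last first.
    exact: map_f (mem_enum _ _).
  by rewrite -[4%N]/(2 * 2)%N exprM sqr_sqrtr ?sqrtr_ge0// sqr_sqrtr// ltW.
rewrite /sqrtm; case: xgetP => [Q _ [sQ _ QM]|/(_ (horner_mx M (q ^+ 2)))] //.
case; split.
- exact: symmetric_horner.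
- move=> z; rewrite rmorphXn/= expr2 -mulmxE -mulmxA dotv_mulmxl.
  by rewrite symmetric_horner// dotvv_ge0.
- by rewrite mulmxE -rmorphM/= -exprD.
Qed.

Section root.
Variables (d : nat) (M : 'M[R]_d).
Hypotheses (d0 : (0 < d)%N) (pM : symposdef M).

Lemma dotv_sqrtm (z : 'cV[R]_d) :
  dotv (sqrtm M *m z) (sqrtm M *m z) = dotv (M *m z) z.
Proof.
have [sQ QM] := symposdef_sqrtm d0 pM.
by rewrite dotv_mulmxl sQ mulmxA QM dotvC.
Qed.

Lemma sqrtm_unit : sqrtm M \in unitmx.
Proof.
have [sQ QM] := symposdef_sqrtm d0 pM.
rewrite -row_free_unit -kermx_eq0; apply/rowV0P => v /sub_kermxP vQ.
apply: contra_eq vQ => v0; apply: contraTneq isT => vQ.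
have := pM.2 v^T; rewrite -trmx0 (inj_eq trmx_inj) v0 => /(_ isT).
by rewrite -dotv_sqrtm -[sqrtm M in X in X -> _]sQ -trmx_mul vQ trmx0 lt_def dotvv_eq0 eqxx.
Qed.

Lemma enorm_gt0 (z : 'cV[R]_d) : z != 0 -> 0 < enorm z.
Proof. by move=> z0; rewrite sqrtr_gt0 dotvv_gt0. Qed.

(** Ellipticity bounds the quotients defining [opnorm], so that its [sup] is a true supremum: c
    |Q^-1 z|^2 <= |z|^2 with Q the root of M. The last conclusion is the operator bound for Q^-1
    applied to Q z. *)
Lemma opnorm_inv_sqrtm (c : R) : 0 < c ->
    (forall z, c * dotv z z <= dotv (M *m z) z) ->
  0 < opnorm (invmx (sqrtm M)) <= (Num.sqrt c)^-1 /\
  forall z, enorm z <= opnorm (invmx (sqrtm M)) * enorm (sqrtm M *m z).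
Proof.
move=> c0 cM; have QU := sqrtm_unit.
have sc0 : 0 < Num.sqrt c by rewrite sqrtr_gt0.
set S := [set enorm (invmx (sqrtm M) *m z) / enorm z | z in [set z | z != 0]].
have Sub : ubound S (Num.sqrt c)^-1.
  move=> _ [z /= z0 <-]; rewrite ler_pdivrMr ?enorm_gt0// ler_pdivlMl//.
  rewrite /enorm -(sqrtrM _ (ltW c0)); apply: ler_wsqrtr.
  by rewrite (le_trans (cM _))// -dotv_sqrtm mulKVmx.
(* A nonzero vector exists since 0 < d; its quotient makes the set nonempty and the supremum
   positive. *)
have c1 : const_mx 1 != 0 :> 'cV[R]_d.
  apply/eqP => /colP/(_ (Ordinal d0)).
  by rewrite !mxE => /eqP; rewrite oner_eq0.
have S1 : S (enorm (invmx (sqrtm M) *m const_mx 1) / enorm (const_mx 1 : 'cV[R]_d)).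
  by exists (const_mx 1).
have hS : has_sup S by split; [eexists; exact: S1|exists (Num.sqrt c)^-1].
split.
  apply/andP; split; last by apply: ge_sup => //; eexists; exact: S1.
  apply: lt_le_trans (sup_ubound hS.2 S1).
  rewrite divr_gt0// ?enorm_gt0//; apply: contra_neq c1 => /(congr1 (mulmx (sqrtm M))).
  by rewrite mulKVmx// mulmx0.
move=> z; have [->|z0] := eqVneq z 0.
  by rewrite mulmx0 /enorm (_ : dotv 0 0 = 0) ?sqrtr0 ?mulr0//; apply/eqP; rewrite dotvv_eq0.
have Qz0 : sqrtm M *m z != 0.
  by apply: contra_neq z0 => /(congr1 (mulmx (invmx (sqrtm M)))); rewrite mulKmx// mulmx0.
rewrite -ler_pdivrMr ?enorm_gt0//; apply: (sup_ubound hS.2).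
by exists (sqrtm M *m z) => //; rewrite mulKmx.
Qed.
End root.
End linear_algebra.

(** * Integration *)

Section nonneg_integral.
Context {dd} {S : measurableType dd} {R : realType}.
Variable mu : {measure set S -> \bar R}.
Local Open Scope ereal_scope.
Import HBNNSimple.

(* f and g need not be measurable: this is applied to functions of sqrtm (a x), which
   is unspecified where a x is not positive definite, and of the initial value u0. *)
Lemma ge0_ae_le_integral (D : set S) (f g : S -> \bar R) :
  (forall x, D x -> 0 <= f x) -> (forall x, D x -> 0 <= g x) ->
  {ae mu, forall x, D x -> f x <= g x} ->
  \int[mu]_(x in D) f x <= \int[mu]_(x in D) g x.
Proof.
move=> f0 g0 [N [mN N0 fgN]]; rewrite !ge0_integralE//.
apply: ge_ereal_sup => _ [h /= hf <-].
have mCN := measurableC mN.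
(* A simple function below f, cut off on the null set N, lies below g and keeps its integral. *)
apply: ereal_sup_ubound; exists (proj_nnsfun h mCN).
  move=> x; rewrite -mrestrict; have [xN|xN] := pselect (N x).
    rewrite patchE memNset/=; last exact.
    by apply: erestrict_ge0 => y Dy; exact: g0.
  rewrite patchE mem_set//; apply: le_trans (hf x) _.
  rewrite !patchE; case: ifPn => // /set_mem Dx.
  by apply: contrapT => nfg; apply: xN; apply: fgN => /(_ Dx).
rewrite -!integralT_nnsfun.
apply: ae_eq_integral => //; try exact/measurable_EFinP.
exists N; split => // x /= /not_implyP[_ hx]; apply: contrapT => xN; apply: hx.
by rewrite /= mindicE mem_set// mulr1.
Qed.

Lemma ge0_ae_eq_integral (D : set S) (f g : S -> \bar R) :
  (forall x, D x -> 0 <= f x) -> (forall x, D x -> 0 <= g x) ->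
  {ae mu, forall x, D x -> f x = g x} ->
  \int[mu]_(x in D) f x = \int[mu]_(x in D) g x.
Proof.
move=> f0 g0 fg; apply/eqP; rewrite eq_le; apply/andP; split;
  by apply: ge0_ae_le_integral => //; apply: filterS fg => x + Dx => /(_ Dx) ->.
Qed.

(** The measures of the sections of a product-null set integrate to 0, so almost all of them vanish.
    This turns bounds on the diffusion coefficient in space-time into bounds in space for almost
    every time. *)
Lemma ae_xsection d2 (S2 : measurableType d2)
   (m1 : {sigma_finite_measure set S -> \bar R})
   (m2 : {sigma_finite_measure set S2 -> \bar R}) (P : S * S2 -> Prop) :
  {ae (m1 \x m2), forall p, P p} -> {ae m1, forall x, {ae m2, forall y, P (x, y)}}.
Proof.
move=> [N [mN N0 PN]].
have : {ae m1, forall x, setT x -> (m2 \o xsection N) x = 0}.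
  have mN2 := measurable_fun_xsection m2 mN.
  apply/(ae_eq_integral_abs m1 measurableT mN2).
  by under eq_integral do rewrite gee0_abs//; exact: N0.
apply: filterS => x /(_ I) /= xN0; exists (xsection N x); split => //.
  exact: measurable_xsection.
by move=> y /= nP; rewrite /xsection/= inE; exact: PN.
Qed.
End nonneg_integral.

(** * Semidefinite forms and square-integrable functions *)

Section abstract_form.
Context {R : realType} {V : Type}.

(* b may be degenerate. The subspace X is a predicate because the spaces of the
   problem are given by representatives. *)
Lemma form_Cauchy_Schwarz (X : (V -> R) -> Prop) (b : (V -> R) -> (V -> R) -> R) v z :
  (forall c v z, X v -> X z -> X (c \*o v \+ z)) ->
  (forall v z, X v -> X z -> b v z = b z v) ->
  (forall v, X v -> 0 <= b v v) ->
  (forall c v v' z, X v -> X v' -> X z -> b (c \*o v \+ v') z = c * b v z + b v' z) ->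
  X v -> X z -> `|b v z| <= Num.sqrt (b v v) * Num.sqrt (b z z).
Proof.
move=> Xlin bC b0 bl Xv Xz.
have Q c e : X (c \*o v \+ e \*o z) /\ 0 <= c ^+ 2 * b v v + 2 * c * e * b v z + e ^+ 2 * b z z.
  (* Closure under c v + z is all that is known of X, so the zero function is reached as - z + z. *)
  have X0 : X (0 \*o z \+ 0 \*o z).
    suff -> : 0 \*o z \+ 0 \*o z = (-1) \*o z \+ z by exact: Xlin.
    by apply/funext => x /=; rewrite !mul0r mulN1r addr0 addNr.
  have Xez : X (e \*o z).
    suff -> : e \*o z = e \*o z \+ (0 \*o z \+ 0 \*o z) by exact: Xlin.
    by apply/funext => x /=; rewrite !mul0r !addr0.
  have Xc := Xlin c _ _ Xv Xez.
  split=> //; have := b0 _ Xc; rewrite bl// (bC v)// (bC (e \*o z) (c \*o v \+ e \*o z))//.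
  have bez y : X y -> b (e \*o z) y = e * b z y.
    move=> Xy; rewrite (_ : e \*o z = e \*o z \+ (0 \*o z \+ 0 \*o z)); last first.
      by apply/funext => x /=; rewrite !mul0r !addr0.
    rewrite bl// (_ : 0 \*o z \+ 0 \*o z = (-1) \*o z \+ z) ?bl//; first by ring.
    by apply/funext => x /=; rewrite !mul0r mulN1r addr0 addNr.
  rewrite (bC (c \*o v \+ e \*o z) v)// (bC (c \*o v \+ e \*o z) (e \*o z))//.
  rewrite (bC v)// (bC (e \*o z) (c \*o v \+ e \*o z))// !bl// (bC v (e \*o z))//.
  rewrite (bC (e \*o z) v)// (bC v (e \*o z))// !bez// (bC z v)// (bC z (e \*o z))// bez//.
  by rewrite (_ : c * _ + _ = c ^+ 2 * b v v + 2 * c * e * b v z + e ^+ 2 * b z z)//; ring.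
rewrite -sqrtrM ?b0// -sqrtr_sqr ler_wsqrtr//.
have {}Q c e := (Q c e).2.
have [zz0|zz0] := eqVneq (b z z) 0.
  have [->|vz0] := eqVneq (b v z) 0; first by rewrite expr0n mulr_ge0// b0.
  (* With b z z = 0 the quadratic is affine in e, and this e gives it the value -1. *)
  have := Q 1 (- (b v v + 1) / (2 * b v z)); rewrite zz0 mulr0 addr0 expr1n mul1r mulr1.
  rewrite (_ : 2 * _ * b v z = - (b v v + 1)); last by field.
  by rewrite opprD addNKr ler0N1.
(* The minimizing ratio of c and e, cleared of its denominator. *)
have := Q (b z z) (- b v z).
rewrite (_ : _ + _ = b z z * (b v v * b z z - b v z ^+ 2)); last by ring.
by rewrite pmulr_rge0 ?subr_ge0// lt_def zz0 b0.
Qed.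

Lemma sqrt_form_triangle (X : (V -> R) -> Prop) (b : (V -> R) -> (V -> R) -> R) v z :
  (forall c v z, X v -> X z -> X (c \*o v \+ z)) ->
  (forall v z, X v -> X z -> b v z = b z v) ->
  (forall v, X v -> 0 <= b v v) ->
  (forall c v v' z, X v -> X v' -> X z -> b (c \*o v \+ v') z = c * b v z + b v' z) ->
  X v -> X z -> Num.sqrt (b (v \+ z) (v \+ z)) <= Num.sqrt (b v v) + Num.sqrt (b z z).
Proof.
move=> Xlin bC b0 bl Xv Xz; have CS := form_Cauchy_Schwarz Xlin bC b0 bl Xv Xz.
have vzE : v \+ z = 1 \*o v \+ z by apply/funext => x /=; rewrite mul1r.
have Xvz : X (v \+ z) by rewrite vzE; exact: Xlin.
have bvz y : X y -> b (v \+ z) y = b v y + b z y.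
  by move=> Xy; rewrite vzE bl// mul1r.
rewrite -[leRHS]ger0_norm ?addr_ge0 ?sqrtr_ge0// -sqrtr_sqr ler_wsqrtr//.
rewrite bvz// (bC v)// (bC z (v \+ z))// !bvz// sqrrD !sqr_sqrtr ?b0//.
rewrite (bC z v)// mulr2n; have := ler_norm (b v z); move: CS; lra.
Qed.

End abstract_form.

Section integrable_EFin.
Context {dd} {S : measurableType dd} {R : realType}.
Variables (mu : {measure set S -> \bar R}) (D : set S) (mD : measurable D).
Implicit Types f g : S -> R.

Lemma integrable_EFinD f g : mu.-integrable D (EFin \o f) ->
  mu.-integrable D (EFin \o g) -> mu.-integrable D (EFin \o (fun x => f x + g x)).
Proof. by move=> If Ig; apply: eq_integrable (integrableD mD If Ig). Qed.

Lemma integrable_EFinB f g : mu.-integrable D (EFin \o f) ->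
  mu.-integrable D (EFin \o g) -> mu.-integrable D (EFin \o (fun x => f x - g x)).
Proof. by move=> If Ig; apply: eq_integrable (integrableB mD If Ig). Qed.

Lemma integrable_EFinZl c f : mu.-integrable D (EFin \o f) ->
  mu.-integrable D (EFin \o (fun x => c * f x)).
Proof. by move=> If; apply: eq_integrable (integrableZl mD c If). Qed.

Lemma integrable_EFin_normr f : mu.-integrable D (EFin \o f) ->
  mu.-integrable D (EFin \o (fun x => `|f x|)).
Proof. by move=> If; apply: eq_integrable (integrable_abse If). Qed.

Lemma le_integrable_EFin f g : measurable_fun D f ->
  mu.-integrable D (EFin \o g) -> (forall x, D x -> `|f x| <= g x) ->
  mu.-integrable D (EFin \o f).
Proof.
move=> mf Ig fg; apply: le_integrable Ig => //; first exact/measurable_EFinP.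
by move=> x Dx; rewrite !abse_EFin lee_fin (le_trans (fg x Dx))// ler_norm.
Qed.

Lemma dominated_Rintegral (f_ : nat -> S -> R) f g :
  (forall n, measurable_fun D (f_ n)) -> measurable_fun D f ->
  (forall x, D x -> (fun n => f_ n x) @ \oo --> f x) ->
  mu.-integrable D (EFin \o g) -> (forall n x, D x -> `|f_ n x| <= g x) ->
  (fun n => \int[mu]_(x in D) f_ n x) @ \oo --> \int[mu]_(x in D) f x.
Proof.
move=> mf_ mf f_f Ig f_g.
have [] := @dominated_convergence _ _ _ mu D mD
  (fun n x => (f_ n x)%:E) (EFin \o f) (EFin \o g) => //.
- by move=> n; exact/measurable_EFinP.
- exact/measurable_EFinP.
- by apply: aeW => x Dx; apply: cvg_EFin; [exact: nearW|exact: f_f].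
- by apply: aeW => x n Dx; rewrite abse_EFin lee_fin f_g.
move=> If _ L; apply: fine_cvg.
by rewrite fineK//; exact: integrable_fin_num.
Qed.

End integrable_EFin.

Section square_integrable.
Context {dd} {S : measurableType dd} {R : realType}.
Variable mu : {measure set S -> \bar R}.
Variables (D : set S) (mD : measurable D).
Implicit Types v z : S -> R.

(** Stated for an arbitrary measure and set, because it serves the domain, the time interval and the
    space-time cylinder alike. *)
Definition sqint v := measurable_fun D v /\
  (\int[mu]_(x in D) ((v x) ^+ 2)%:E < +oo)%E.

Definition ip v z : R := \int[mu]_(x in D) (v x * z x).

Lemma sqint_integrable_sqr v : sqint v -> mu.-integrable D (fun x => (v x ^+ 2)%:E).
Proof.
move=> [mv vfin]; apply/integrableP; split.
  by apply/measurable_EFinP; exact: measurable_funX.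
by under eq_integral do rewrite gee0_abs ?lee_fin ?sqr_ge0//.
Qed.

Lemma sqint_integrable_mul v z : sqint v -> sqint z ->
  mu.-integrable D (fun x => (v x * z x)%:E).
Proof.
move=> Lv Lz; have [mv _] := Lv; have [mz _] := Lz.
apply: (@le_integrable _ _ _ mu D mD _ (fun x => (v x ^+ 2)%:E + (z x ^+ 2)%:E)%E).
- by apply/measurable_EFinP; exact: measurable_funM.
- move=> x _; rewrite -EFinD !abse_EFin lee_fin.
  have := sqr_ge0 (v x + z x); have := sqr_ge0 (v x - z x).
  rewrite (@ger0_norm _ (v x ^+ 2 + z x ^+ 2)) ?addr_ge0 ?sqr_ge0//.
  by case: (ler0P (v x * z x)) => _; nra.
- by apply: integrableD => //; exact: sqint_integrable_sqr.
Qed.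

Lemma sqint_lincomb c v z : sqint v -> sqint z -> sqint (c \*o v \+ z).
Proof.
move=> Lv Lz; have [mv _] := Lv; have [mz _] := Lz.
split; first by apply: measurable_funD => //; exact: measurable_funM.
apply: integrable_lty => //.
have -> : (fun x => ((c * v x + z x) ^+ 2)%:E) =
    (fun x => (c ^+ 2)%:E * (v x ^+ 2)%:E + (2 * c)%:E * (v x * z x)%:E + (z x ^+ 2)%:E)%E.
  by apply/funext => x; rewrite -!EFinM -!EFinD; congr EFin; ring.
by apply: integrableD => //; [apply: integrableD => //; apply: integrableZl => //|];
  [exact: sqint_integrable_sqr|exact: sqint_integrable_mul|exact: sqint_integrable_sqr].
Qed.

Lemma ipC v z : ip v z = ip z v.
Proof. by apply: eq_Rintegral => x _; rewrite mulrC. Qed.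

Lemma ip_lincombl c v v' z : sqint v -> sqint v' -> sqint z ->
  ip (c \*o v \+ v') z = c * ip v z + ip v' z.
Proof.
move=> Lv Lv' Lz; have I1 := sqint_integrable_mul Lv Lz; have I2 := sqint_integrable_mul Lv' Lz.
rewrite /ip -RintegralZl// -RintegralD//; last exact: (integrableZl mD c I1).
by apply: eq_Rintegral => x _; rewrite /= mulrDl mulrA.
Qed.

Lemma ip_ge0 v : 0 <= ip v v.
Proof. by apply: Rintegral_ge0 => x _; rewrite -expr2 sqr_ge0. Qed.

Lemma sqint_triangle v z : sqint v -> sqint z ->
  Num.sqrt (ip (v \+ z) (v \+ z)) <= Num.sqrt (ip v v) + Num.sqrt (ip z z).
Proof.
by apply: sqrt_form_triangle => *;
  [exact: sqint_lincomb|exact: ipC|exact: ip_ge0|exact: ip_lincombl].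
Qed.

Lemma sqint_Cauchy_Schwarz v z : sqint v -> sqint z ->
  `|ip v z| <= Num.sqrt (ip v v) * Num.sqrt (ip z z).
Proof.
by apply: form_Cauchy_Schwarz => *;
  [exact: sqint_lincomb|exact: ipC|exact: ip_ge0|exact: ip_lincombl].
Qed.

End square_integrable.

Section L2_space.
Context {R : realType} {d : nat}.
Variable Om : set 'rV[R]_d.
Hypothesis oOm : open Om.
Local Notation mu := (@lebesgue_rV R d).
Local Notation E := 'rV[R]_d.
Implicit Types (v z phi : E -> R) (G : E -> 'cV[R]_d).

Lemma measurable_open (A : set E) : open A -> measurable A.
Proof. by move=> oA; apply: sub_sigma_algebra. Qed.

Let mOm : measurable Om := measurable_open oOm.

Lemma L2_integrable_mul v z : L2 Om v -> L2 Om z ->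
  mu.-integrable Om (fun x => (v x * z x)%:E).
Proof. exact: sqint_integrable_mul. Qed.

Lemma L2_lincomb c v z : L2 Om v -> L2 Om z -> L2 Om (c \*o v \+ z).
Proof. exact: sqint_lincomb. Qed.

Lemma L2_0 : L2 Om (fun=> 0).
Proof. by split => //; under eq_integral do rewrite expr0n/=; rewrite integral0. Qed.

Lemma L2D v z : L2 Om v -> L2 Om z -> L2 Om (v \+ z).
Proof.
have -> : v \+ z = 1 \*o v \+ z by apply/funext => x /=; rewrite mul1r.
exact: L2_lincomb.
Qed.

Lemma L2B v z : L2 Om v -> L2 Om z -> L2 Om (v \- z).
Proof.
have -> : v \- z = (-1) \*o z \+ v by apply/funext => x /=; rewrite mulN1r addrC.
by move=> Lv Lz; exact: L2_lincomb.
Qed.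

Lemma innerC v z : inner Om v z = inner Om z v.
Proof. exact: ipC. Qed.

Lemma inner_lincombl c v v' z : L2 Om v -> L2 Om v' -> L2 Om z ->
  inner Om (c \*o v \+ v') z = c * inner Om v z + inner Om v' z.
Proof. exact: ip_lincombl. Qed.

Lemma innerDl v v' z : L2 Om v -> L2 Om v' -> L2 Om z ->
  inner Om (v \+ v') z = inner Om v z + inner Om v' z.
Proof.
move=> Lv Lv' Lz; rewrite (_ : v \+ v' = 1 \*o v \+ v') ?inner_lincombl ?mul1r//.
by apply/funext => x /=; rewrite mul1r.
Qed.

Lemma innerBl v v' z : L2 Om v -> L2 Om v' -> L2 Om z ->
  inner Om (v \- v') z = inner Om v z - inner Om v' z.
Proof.
move=> Lv Lv' Lz; rewrite (_ : v \- v' = (-1) \*o v' \+ v) ?inner_lincombl//; first by ring.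
by apply/funext => x /=; rewrite mulN1r addrC.
Qed.

Lemma inner_ge0 v : 0 <= inner Om v v.
Proof. exact: ip_ge0. Qed.

Lemma inner_Cauchy_Schwarz v z : L2 Om v -> L2 Om z ->
  `|inner Om v z| <= L2norm Om v * L2norm Om z.
Proof. exact: sqint_Cauchy_Schwarz. Qed.

Lemma L2norm_triangle v z : L2 Om v -> L2 Om z ->
  L2norm Om (v \+ z) <= L2norm Om v + L2norm Om z.
Proof. exact: sqint_triangle. Qed.

Lemma sqr_L2norm v : L2norm Om v ^+ 2 = inner Om v v.
Proof. by rewrite sqr_sqrtr ?inner_ge0. Qed.

Lemma ae_eq_inner v v' z z' : L2 Om v -> L2 Om v' -> L2 Om z -> L2 Om z' ->
  ae_eq_on Om v v' -> ae_eq_on Om z z' -> inner Om v z = inner Om v' z'.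
Proof.
move=> [mv _] [mv' _] [mz _] [mz' _] vv' zz'; congr fine.
apply: ae_eq_integral => //; try by apply/measurable_EFinP; exact: measurable_funM.
by apply: filterS2 vv' zz' => x + + Dx => /(_ Dx) -> /(_ Dx) ->.
Qed.

Lemma inner_eq0 v : L2 Om v -> inner Om v v = 0 -> ae_eq_on Om v (fun=> 0).
Proof.
move=> Lv v0; have I1 := L2_integrable_mul Lv Lv.
have : {ae mu, forall x, Om x -> (v x * v x)%:E = 0%E}.
  apply/(ae_eq_integral_abs mu mOm (measurable_int _ I1)).
  under eq_integral do rewrite gee0_abs ?lee_fin -?expr2 ?sqr_ge0//.
  have /fineK <- := integrable_fin_num mOm (sqint_integrable_sqr Lv).
  by rewrite -[RHS]/(0%:E) -v0 /inner /Rintegral; under eq_integral do rewrite expr2.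
by apply: filterS => x + Dx => /(_ Dx) [] /eqP; rewrite mulf_eq0 orbb => /eqP.
Qed.

End L2_space.

(** * The spaces L_2 and H^1_0 *)

Section test_functions.
Context {R : realType} {d : nat}.
Variable Om : set 'rV[R]_d.
Hypotheses (oOm : open Om) (bOm : bounded_set Om).
Local Notation mu := (@lebesgue_rV R d).
Local Notation E := 'rV[R]_d.
Implicit Types (v z phi psi : E -> R) (G : E -> 'cV[R]_d).

Let mOm : measurable Om := measurable_open oOm.

Lemma bounded_measure_fin : (mu Om < +oo)%E.
Proof.
have [M [Mr OmM]] := bOm.
pose r : R := `|M| + 1.
have Or : Om `<=` rbox (\row_(i < d) (- (r + 1))) (\row_(i < d) (r + 1)).
  move=> x Omx i; rewrite !mxE.
  have /= xr : `|x| <= r by apply: OmM => //; rewrite /r; have := ler_norm M; lra.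
  rewrite -ltr_norml; apply: le_lt_trans (_ : r < r + 1); last by rewrite ltrDl.
  apply: le_trans xr; rewrite /Num.norm/= mx_normrE.
  by apply: (le_bigmax_cond 0 (fun ij : 'I_1 * 'I_d => `|x ij.1 ij.2|) (j := (0, i))).
apply: le_lt_trans (le_measure mu _ _ Or) _; rewrite ?inE//.
  exact: measurable_rbox.
rewrite [X in (X < _)%E]lebesgue_rV_box ?ltry// => i; rewrite !mxE /r.
by have := normr_ge0 M; lra.
Qed.

(** Om has finite measure, and phi is bounded on the compact closure of Om. *)
Lemma continuous_L2 phi : continuous phi -> L2 Om phi.
Proof.
move=> cphi.
have mphi : measurable_fun Om phi.
  apply: measurable_funTS.
  apply: (measurability _ (RGenOInfty.measurableE R)).
  move=> _ [_ [a ->] <-]; rewrite setTI; apply: sub_sigma_algebra.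
  have : open `]a, +oo[%classic by exact: rray_open.
  by apply: open_comp => x _; exact: cphi.
split=> //.
have cOm : compact (closure Om).
  apply: bounded_closed_compact; last exact: closed_closure.
  have [M [Mr OmM]] := bOm; exists (`|M| + 1); split => // x Mx y.
  have cb : closed [set y : E | `|y| <= x].
    by apply: closed_comp (fun y : E => `|y|) _ _ (@closed_le R x) => y0 _; exact: norm_continuous.
  move=> cy; suff : [set y : E | `|y| <= x] y by [].
  rewrite ((closure_id _).1 cb); move: cy; apply: closure_subset => z Omz /=.
  by apply: OmM => //; have := ler_norm M; lra.
have [M [Mr OmM]] : [bounded phi x | x in closure Om].
  have : compact (phi @` closure Om).
    by apply: continuous_compact => //; apply: continuous_subspaceT => x; exact: cphi.
  by move=> /compact_bounded [M [Mr h]]; exists M; split => // x Mx y cy; apply: h => //; exists y.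
apply: integrable_lty => //.
apply: measurable_bounded_integrable => //.
- exact: bounded_measure_fin.
- exact: measurable_funX.
- exists ((`|M| + 1) ^+ 2); split; first exact: num_real.
  move=> x Mx y Omy /=; apply/ltW/(le_lt_trans _ Mx).
  rewrite normrX; apply: lerXn2r; rewrite ?nnegrE ?addr_ge0//.
  by apply: OmM; [have := ler_norm M; lra|exact: subset_closure].
Qed.

Lemma Ck_continuous k phi : Ck k phi -> continuous phi.
Proof. by case: k => [|k] []. Qed.

Lemma partial_lincomb i c phi psi :
  (forall x, derivable phi x (delta_mx 0 i)) ->
  (forall x, derivable psi x (delta_mx 0 i)) ->
  (forall x, derivable (c \*o phi \+ psi) x (delta_mx 0 i)) /\
  partial i (c \*o phi \+ psi) = c \*o partial i phi \+ partial i psi.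
Proof.
move=> dphi dpsi.
have dcphi x : derivable (c \*o phi) x (delta_mx 0 i) by exact: derivableZ.
split=> [x|]; first exact: derivableD.
by apply/funext => x; rewrite /partial deriveD// deriveZ.
Qed.

Lemma Ck_lincomb k c phi psi : Ck k phi -> Ck k psi -> Ck k (c \*o phi \+ psi).
Proof.
elim: k phi psi => [|k IH] phi psi [cphi hphi] [cpsi hpsi].
  by split=> // x; exact: (cvgD (cvgM (cvg_cst c) (cphi x)) (cpsi x)).
split=> [x|i]; first exact: (cvgD (cvgM (cvg_cst c) (cphi x)) (cpsi x)).
have [d1 C1] := hphi i; have [d2 C2] := hpsi i.
have [dl ->] := partial_lincomb c d1 d2.
by split=> //; exact: IH.
Qed.

Lemma test_function_lincomb c phi psi : test_function Om phi ->
  test_function Om psi -> test_function Om (c \*o phi \+ psi).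
Proof.
move=> [sphi [K [cK KOm K0]]] [spsi [L [cL LOm L0]]]; split.
  by move=> k; exact: Ck_lincomb.
exists (K `|` L); split; first exact: compactU.
  by rewrite subUset.
by move=> x /not_orP[nK nL] /=; rewrite K0// L0// mulr0 addr0.
Qed.

Lemma test_function_L2 phi : test_function Om phi -> L2 Om phi.
Proof. by move=> [/(_ 0%N)/Ck_continuous cphi _]; exact: continuous_L2. Qed.

Lemma test_function_partial phi i : test_function Om phi ->
  (forall x, derivable phi x (delta_mx 0 i)) /\ L2 Om (partial i phi).
Proof.
move=> [/(_ 1%N)[_ /(_ i)[dphi [cphi _]]] _]; split => //.
exact: continuous_L2.
Qed.

Lemma weak_gradient_lincomb c v z G G' : L2 Om v -> L2 Om z ->
  weak_gradient Om v G -> weak_gradient Om z G' ->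
  weak_gradient Om (c \*o v \+ z) (fun x => c *: G x + G' x).
Proof.
move=> Lv Lz [LG vG] [LG' zG'].
have GE i : (fun x => (c *: G x + G' x) i 0) =
    c \*o (fun x => G x i 0) \+ (fun x => G' x i 0).
  by apply/funext => x; rewrite !mxE.
split=> [i|phi i tphi]; first by rewrite GE; exact: L2_lincomb.
have [_ Lphi] := test_function_partial i tphi.
have Lp := test_function_L2 tphi.
by rewrite GE !inner_lincombl// vG// zG'// mulrN opprD.
Qed.

Lemma dotv_L2vec_integrable G G' : L2vec Om G -> L2vec Om G' ->
  mu.-integrable Om (fun x => (dotv (G x) (G' x))%:E).
Proof.
move=> LG LG'.
have -> : (fun x => (dotv (G x) (G' x))%:E) = (fun x => \sum_(i < d) (G x i 0 * G' x i 0)%:E)%E.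
  by apply/funext => x; rewrite sumEFin.
apply: integrable_sum => // i _.
exact: L2_integrable_mul.
Qed.

Lemma L2vec_lincomb c G G' : L2vec Om G -> L2vec Om G' ->
  L2vec Om (fun x => c *: G x + G' x).
Proof.
move=> LG LG' i.
have -> : (fun x => (c *: G x + G' x) i 0) =
    c \*o (fun x => G x i 0) \+ (fun x => G' x i 0).
  by apply/funext => x; rewrite !mxE.
exact: L2_lincomb.
Qed.

Lemma L2norm_lincomb c v z : L2 Om v -> L2 Om z ->
  L2norm Om (c \*o v \+ z) <= `|c| * L2norm Om v + L2norm Om z.
Proof.
move=> Lv Lz.
have L0 := L2_0 Om.
have cvE : c \*o v = c \*o v \+ (fun=> 0) by apply/funext => x /=; rewrite addr0.
have Lcv : L2 Om (c \*o v) by rewrite cvE; exact: L2_lincomb.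
apply: le_trans (L2norm_triangle oOm Lcv Lz) _.
rewrite lerD2r -sqrtr_sqr -sqrtrM ?sqr_ge0// {1}/L2norm.
suff -> : inner Om (c \*o v) (c \*o v) = c ^+ 2 * inner Om v v by [].
rewrite /inner -RintegralZl//; last exact: L2_integrable_mul.
by apply: eq_Rintegral => x _ /=; ring.
Qed.

Lemma cgrad_lincomb c phi psi : test_function Om phi -> test_function Om psi ->
  cgrad (c \*o phi \+ psi) = fun x => c *: cgrad phi x + cgrad psi x.
Proof.
move=> tphi tpsi; apply/funext => x; apply/colP => i; rewrite !mxE.
have [dphi _] := test_function_partial i tphi.
have [dpsi _] := test_function_partial i tpsi.
by have [_ ->] := partial_lincomb c dphi dpsi.
Qed.

Lemma cgrad_L2vec phi : test_function Om phi -> L2vec Om (cgrad phi).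
Proof.
move=> tphi i; have [_] := test_function_partial i tphi.
rewrite (_ : (fun x => cgrad phi x i 0) = partial i phi)//.
by apply/funext => x; rewrite mxE.
Qed.

(** The crude factor 2 comes from (x + y)^2 <= 2 x^2 + 2 y^2 taken pointwise; it is harmless, since
    the bound is only used for approximations that can be made arbitrarily good. *)
Lemma L2vnorm_lincomb c G G' : L2vec Om G -> L2vec Om G' ->
  L2vnorm Om (fun x => c *: G x + G' x) <= 2 * (`|c| * L2vnorm Om G + L2vnorm Om G').
Proof.
move=> LG LG'.
have I0 G1 : 0 <= \int[mu]_(x in Om) dotv (G1 x) (G1 x).
  by apply: Rintegral_ge0 => x _; exact: dotvv_ge0.
have le2 : \int[mu]_(x in Om) dotv (c *: G x + G' x) (c *: G x + G' x) <=
    \int[mu]_(x in Om) (2 * c ^+ 2 * dotv (G x) (G x) + 2 * dotv (G' x) (G' x)).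
  have LGG' := L2vec_lincomb c LG LG'.
  have I1 := dotv_L2vec_integrable LG LG; have I2 := dotv_L2vec_integrable LG' LG'.
  apply: le_Rintegral => //; first exact: dotv_L2vec_integrable.
    exact: (integrableD mOm (integrableZl mOm (2 * c ^+ 2) I1) (integrableZl mOm 2 I2)).
  move=> x _; rewrite /dotv !mulr_sumr -big_split/=; apply: ler_sum => i _.
  rewrite !mxE; have := sqr_ge0 (c * G x i 0 - G' x i 0); nra.
rewrite /L2vnorm.
have {}le2 : \int[mu]_(x in Om) dotv (c *: G x + G' x) (c *: G x + G' x) <=
    2 * c ^+ 2 * \int[mu]_(x in Om) dotv (G x) (G x) + 2 * \int[mu]_(x in Om) dotv (G' x) (G' x).
  have I1 := dotv_L2vec_integrable LG LG; have I2 := dotv_L2vec_integrable LG' LG'.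
  rewrite -!RintegralZl// -RintegralD//.
    exact: (integrableZl mOm (2 * c ^+ 2) I1).
  exact: (integrableZl mOm 2 I2).
set a := \int[mu]_(x in Om) dotv (G x) (G x) in le2 *.
set b := \int[mu]_(x in Om) dotv (G' x) (G' x) in le2 *.
have a0 : 0 <= a by exact: I0. have b0 : 0 <= b by exact: I0.
have P : 0 <= 2 * (`|c| * Num.sqrt a + Num.sqrt b).
  by rewrite mulr_ge0// addr_ge0 ?mulr_ge0 ?sqrtr_ge0.
rewrite -[leRHS]ger0_norm// -sqrtr_sqr ler_wsqrtr// (le_trans le2)//.
have := sqr_sqrtr a0; have := sqr_sqrtr b0; have := real_normK (num_real c).
have := sqrtr_ge0 a; have := sqrtr_ge0 b; have := normr_ge0 c.
move: (Num.sqrt a) (Num.sqrt b) `|c| => x y e e0 y0 x0 <- <- <-.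
have : 0 <= (e * x) * y by rewrite !mulr_ge0.
have := sqr_ge0 (e * x); have := sqr_ge0 y; lra.
Qed.

Lemma H10_lincomb c v z : H10 Om v -> H10 Om z -> H10 Om (c \*o v \+ z).
Proof.
move=> [Lv [G vG Gap]] [Lz [G' zG' G'ap]]; split; first exact: L2_lincomb.
exists (fun x => c *: G x + G' x); first exact: weak_gradient_lincomb.
(* The outer 2 is the factor of [L2vnorm_lincomb]; taking |c| + 2 instead of |c| + 1 leaves a strict
   inequality. *)
move=> e e0; pose e' := e / (2 * (`|c| + 2)).
have c2 : 0 < 2 * (`|c| + 2) by rewrite mulr_gt0// addr_ge0_gt0.
have e'0 : 0 < e' by rewrite divr_gt0.
have eE : 2 * (`|c| * e' + e') < e.
  have -> : e = 2 * (`|c| + 2) * e' by rewrite /e' mulrC divfK// gt_eqF.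
  by lra.
have [phi [tphi phiv phiG]] := Gap _ e'0; have [psi [tpsi psiz psiG]] := G'ap _ e'0.
have [LG _] := vG; have [LG' _] := zG'.
have sub (h h' : E -> R) : L2 Om h -> L2 Om h' -> L2 Om (h \- h').
  move=> Lh Lh'; rewrite (_ : h \- h' = (-1) \*o h' \+ h); first exact: L2_lincomb.
  by apply/funext => x /=; rewrite mulN1r addrC.
have subv (H H' : E -> 'cV[R]_d) : L2vec Om H -> L2vec Om H' -> L2vec Om (fun x => H x - H' x).
  move=> LH LH'; rewrite (_ : (fun x => _) = fun x => (-1) *: H' x + H x).
    exact: L2vec_lincomb.
  by apply/funext => x /=; rewrite scaleN1r addrC.
have le1 a b : 0 <= a -> 0 <= b -> a < e' -> b < e' -> 2 * (`|c| * a + b) < e.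
  move=> a0 b0 ae be; apply: le_lt_trans eE; rewrite ler_pM2l//.
  by apply: lerD; [apply: ler_wpM2l => //|]; exact: ltW.
exists (c \*o phi \+ psi); split.
- exact: test_function_lincomb.
- have -> : (c \*o v \+ z) \- (c \*o phi \+ psi) = c \*o (v \- phi) \+ (z \- psi).
    by apply/funext => x /=; ring.
  have Lvp := sub _ _ Lv (test_function_L2 tphi).
  have Lzp := sub _ _ Lz (test_function_L2 tpsi).
  apply: le_lt_trans (L2norm_lincomb c Lvp Lzp) _.
  apply: le_lt_trans (le1 _ _ (sqrtr_ge0 _) (sqrtr_ge0 _) phiv psiz).
  by rewrite ler_peMl ?ler1n// addr_ge0 ?mulr_ge0 ?sqrtr_ge0.
- rewrite cgrad_lincomb//.
  have -> : (fun x => c *: G x + G' x - (c *: cgrad phi x + cgrad psi x)) =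
      (fun x => c *: (G x - cgrad phi x) + (G' x - cgrad psi x)).
    by apply/funext => x /=; rewrite scalerBr opprD !addrA; congr (_ - _); rewrite addrAC.
  have LGp := subv _ _ LG (cgrad_L2vec tphi).
  have LGz := subv _ _ LG' (cgrad_L2vec tpsi).
  apply: le_lt_trans (L2vnorm_lincomb c LGp LGz) _.
  exact: le1 (sqrtr_ge0 _) (sqrtr_ge0 _) phiG psiG.
Qed.

(** [grad] is a choice with default 0; membership in [H10] provides a candidate, so the chosen field
    is a genuine weak gradient. *)
Lemma grad_weak_gradient v : H10 Om v -> weak_gradient Om v (grad Om v).
Proof. by move=> [_ [G vG _]]; apply: (xgetPex (fun=> 0)); exists G. Qed.
End test_functions.
(** * Weak derivatives in time *)

Section smoothstep.
Context {R : realType}.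
Implicit Types a e r x : R.

Definition pos_part x : R := Num.max x 0.

(** A remainder of order h^2, uniform across the kink at 0, makes the squared positive part
    differentiable everywhere. *)
Lemma pos_part_sqr_expansion x h :
  `|pos_part (x + h) ^+ 2 - pos_part x ^+ 2 - 2 * pos_part x * h| <= h ^+ 2.
Proof.
rewrite ler_norml /pos_part /Num.max.
by case: ltP => ?; case: ltP => ?; nra.
Qed.

Lemma is_derive_pos_part_sqr x :
  is_derive x 1 (fun y => pos_part y ^+ 2) (2 * pos_part x).
Proof.
have lim : (fun h => h^-1 *: ((pos_part (h *: 1 + x) ^+ 2 : R) - pos_part x ^+ 2)) @ 0^' -->
    (2 * pos_part x : R).
  apply/cvgrPdist_le => /= eps eps0; near=> h.
  have h0 : h != 0 by near: h; exact: nbhs_dnbhs_neq.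
  rewrite /GRing.scale/= mulr1 distrC.
  have -> : h^-1 * (pos_part (h + x) ^+ 2 - pos_part x ^+ 2) - 2 * pos_part x =
      h^-1 * (pos_part (x + h) ^+ 2 - pos_part x ^+ 2 - 2 * pos_part x * h).
    by rewrite (addrC h); field.
  rewrite normrM normfV ler_pdivrMl ?normr_gt0//.
  apply: le_trans (pos_part_sqr_expansion x h) _.
  rewrite -real_normK ?num_real// expr2 ler_wpM2l//.
  near: h; apply: dnbhs0_le; exact: eps0.
apply: DeriveDef; last exact/cvg_lim.
exact/cvgP/lim.
Unshelve. all: by end_near. Qed.

Lemma continuous_pos_part : continuous pos_part.
Proof. by move=> x; apply: continuous_max => //; exact: cvg_cst. Qed.

(* Half the second difference of pos_part ^+ 2 is a C^1 step from 0 (for r <= a - e)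
   to 1 (for r >= a + e). *)
Definition smoothstep a e r : R :=
  (2 * e ^+ 2)^-1 * (pos_part (r - a + e) ^+ 2 - 2 * pos_part (r - a) ^+ 2
                     + pos_part (r - a - e) ^+ 2).

(** The tent of height 1/e over ]a - e, a + e[, an approximate Dirac mass at a; it is the derivative
    of [smoothstep a e]. *)
Definition hat a e r : R :=
  (e ^+ 2)^-1 * (pos_part (r - a + e) - 2 * pos_part (r - a) + pos_part (r - a - e)).

Lemma is_derive_smoothstep a e r : is_derive r 1 (smoothstep a e) (hat a e r).
Proof.
have sh b : is_derive r 1 (fun y => pos_part (y + b) ^+ 2) (2 * pos_part (r + b)).
  rewrite -[X in is_derive _ _ _ X]mulr1.
  apply: (@is_derive1_comp _ (fun y => pos_part y ^+ 2) (fun y => y + b) r).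
    exact: is_derive_pos_part_sqr.
  exact: is_derive_shift.
have -> : smoothstep a e = (2 * e ^+ 2)^-1 \*: ((fun y => pos_part (y + (e - a)) ^+ 2) +
     (- 2) \*: (fun y => pos_part (y + - a) ^+ 2) + (fun y => pos_part (y + (- a - e)) ^+ 2)).
  apply/funext => y.
  transitivity ((2 * e ^+ 2)^-1 * (pos_part (y + (e - a)) ^+ 2 +
    (- 2) * pos_part (y + - a) ^+ 2 + pos_part (y + (- a - e)) ^+ 2)); last by [].
  rewrite /smoothstep mulNr (_ : y + (e - a) = y - a + e); last by ring.
  by rewrite (_ : y + (- a - e) = y - a - e)//; ring.
have -> : hat a e r = (2 * e ^+ 2)^-1 *: (2 * pos_part (r + (e - a)) +
    (- 2) *: (2 * pos_part (r - a)) + 2 * pos_part (r + (- a - e))).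
  transitivity ((2 * e ^+ 2)^-1 * (2 * pos_part (r + (e - a)) +
    (- 2) * (2 * pos_part (r - a)) + 2 * pos_part (r + (- a - e)))); last by [].
  rewrite (_ : r + (e - a) = r - a + e); last by ring.
  rewrite (_ : r + (- a - e) = r - a - e); last by ring.
  have -> : (2 * e ^+ 2)^-1 = 2^-1 * (e ^+ 2)^-1 by rewrite invfM.
  by rewrite /hat; move: (e ^+ 2)^-1 => y; field.
have sh1 := sh (e - a); have sh2 := sh (- a); have sh3 := sh (- a - e).
by apply: is_deriveZ.
Qed.

Lemma continuous_hat a e : continuous (hat a e).
Proof.
move=> r; apply: cvgM; first exact: cvg_cst.
have sh b : pos_part (y + b) @[y --> r] --> pos_part (r + b).
  apply: (@continuous_comp _ _ _ (fun y => y + b) pos_part); last exact: continuous_pos_part.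
  by apply: cvgD; [exact: cvg_id|exact: cvg_cst].
apply: cvgD; last by have := sh (- a - e); under eq_fun do rewrite addrA; rewrite addrA.
apply: cvgB; first by have := sh (- a + e); under eq_fun do rewrite addrA; rewrite addrA.
by apply: cvgM; [exact: cvg_cst|exact: sh].
Qed.

Lemma smoothstep_le a e r : 0 < e -> r <= a - e -> smoothstep a e r = 0.
Proof.
move=> e0 re; rewrite /smoothstep /pos_part !max_r ?expr0n ?mulr0 ?subr0 ?addr0 ?mulr0//; lra.
Qed.

Lemma smoothstep_ge a e r : 0 < e -> a + e <= r -> smoothstep a e r = 1.
Proof.
move=> e0 re; rewrite /smoothstep /pos_part !max_l; [|lra..].
by field; rewrite gt_eqF.
Qed.

Lemma smoothstep_ge0_le1 a e r : 0 < e -> 0 <= smoothstep a e r <= 1.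
Proof.
move=> e0; have [re|re] := leP r (a - e); first by rewrite smoothstep_le// lexx ler01.
have [re'|re'] := leP (a + e) r; first by rewrite smoothstep_ge// lexx ler01.
have e2 : 0 < 2 * e ^+ 2 by rewrite mulr_gt0// exprn_gt0.
rewrite /smoothstep mulrC ler_pdivlMr// mul0r ler_pdivrMr// mul1r.
rewrite /pos_part (max_l (_ : 0 <= r - a + e)); last lra.
rewrite (max_r (_ : r - a - e <= 0)); last lra.
by rewrite /Num.max; case: ltP => ra; apply/andP; split; nra.
Qed.

Lemma hat_ge0 a e r : 0 < e -> 0 <= hat a e r.
Proof.
move=> e0; rewrite /hat mulr_ge0// ?invr_ge0 ?sqr_ge0//.
by rewrite /pos_part /Num.max; do 3 case: ltP => ?; lra.
Qed.

Lemma hat_out a e r : 0 < e -> e <= `|r - a| -> hat a e r = 0.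
Proof.
move=> e0; rewrite /hat /pos_part /Num.max ler_normr => h.
have H x : x = 0 -> (e ^+ 2)^-1 * x = 0 by move=> ->; rewrite mulr0.
by apply: H; case/orP: h => h; do 3 case: ltP => ?; lra.
Qed.

End smoothstep.
Section weak_primitive.
Context {R : realType}.
Variables (T : R).
Hypothesis T0 : 0 < T.
Local Notation lam := (@lebesgue_measure R).
Implicit Types h k th : R -> R.

(** The scalar counterpart of [time_continuous_at], with one-sided limits at 0 and T built in. *)
Definition continuous_on_at h (t : R) := forall e, 0 < e -> exists2 del, 0 < del &
  forall s : R, s \in `[0, T] -> `|s - t| < del -> `|h s - h t| < e.

Lemma continuous_on_within h :
  (forall t : R, t \in `[0, T] -> continuous_on_at h t) ->
  {within `[0, T], continuous h}.
Proof.
move=> ch; apply/continuous_within_itvP => //; split.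
- move=> t tT; apply/cvgrPdist_lt => e e0.
  have [del del0 hdel] := ch t (subset_itv_oo_cc tT) e e0.
  near=> s; rewrite distrC; apply: hdel.
    by apply: subset_itv_oo_cc; near: s; exact: near_in_itvoo.
  by rewrite distrC; near: s; exact: (@nbhsx_ballx _ R).
- apply/cvgrPdist_lt => e e0.
  have [|del del0 hdel] := ch 0 _ e e0; first by rewrite in_itv/= lexx ltW.
  near=> s; rewrite distrC; apply: hdel.
    by rewrite in_itv/=; apply/andP; split; apply/ltW.
  rewrite subr0 gtr0_norm//; near: s; exact: nbhs_right_lt.
- apply/cvgrPdist_lt => e e0.
  have [|del del0 hdel] := ch T _ e e0; first by rewrite in_itv/= lexx ltW.
  near=> s; rewrite distrC; apply: hdel.
    by rewrite in_itv/=; apply/andP; split; apply/ltW => //; near: s; exact: nbhs_left_gt.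
  rewrite ltr0_norm ?subr_lt0// opprB ltrBlDr addrC -ltrBlDr; near: s; apply: nbhs_left_gt.
  by rewrite ltrBlDr ltrDl.
Unshelve. all: by end_near. Qed.

Lemma continuous_itv_integrable a b h : {within `[a, b], continuous h} ->
  lam.-integrable `[a, b] (EFin \o h).
Proof. by move=> ch; apply: continuous_compact_integrable => //; exact: segment_compact. Qed.

Lemma derive1_smoothstep (a e : R) : derive1 (smoothstep a e) = hat a e.
Proof.
by apply/funext => r; rewrite derive1E; have /@derive_val -> := is_derive_smoothstep a e r.
Qed.

Lemma Rintegral_hat (a e : R) : 0 < e -> 0 <= a - e -> a + e <= T ->
  \int[lam]_(r in `[0, T]) hat a e r = 1.
Proof.
move=> e0 ae aT; rewrite /Rintegral.
rewrite (@continuous_FTC2 _ (hat a e) (smoothstep a e) 0 T T0).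
- by rewrite (smoothstep_le e0 ae) (smoothstep_ge e0 aT)/= subr0.
- by apply: continuous_subspaceT => x; exact: continuous_hat.
- have dS x : derivable (smoothstep a e) x 1 by have [] := is_derive_smoothstep a e x.
  have cS : continuous (smoothstep a e).
    by move=> x; apply: differentiable_continuous; exact/derivable1_diffP.
  by split=> [x _||]//; [exact/cvg_at_right_filter/cS|exact/cvg_at_left_filter/cS].
- by move=> x _; rewrite derive1_smoothstep.
Qed.

(** The tent is a probability density, so c moves under the integral and only values of h near a
    count. The value c is free because the tents used below are centred slightly off the point at
    which h is recovered. *)
Lemma hat_average (a e : R) h (eta : R) : 0 < e -> 0 <= a - e -> a + e <= T ->
  {within `[0, T], continuous h} -> forall c,
  (forall r : R, r \in `[0, T] -> `|r - a| < e -> `|h r - c| <= eta) ->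
  `|\int[lam]_(r in `[0, T]) (h r * hat a e r) - c| <= eta.
Proof.
move=> e0 ae aT ch c hc.
have cH : {within `[0, T], continuous (hat a e)}.
  by apply: continuous_subspaceT => x; exact: continuous_hat.
have IH := continuous_itv_integrable cH.
have IhH : lam.-integrable `[0, T] (EFin \o (fun r => h r * hat a e r)).
  apply: continuous_itv_integrable => x; apply: continuousM; [exact: ch|exact: cH].
rewrite -[X in _ - X]mulr1 -(Rintegral_hat e0 ae aT) -RintegralZl// -RintegralB//; last first.
  exact: (integrableZl _ c IH).
apply: le_trans (le_normr_Rintegral _ _) _ => //.
  by apply: integrable_EFinB => //; exact: integrable_EFinZl.
rewrite -[leRHS]mulr1 -(Rintegral_hat e0 ae aT) -RintegralZl//.
apply: le_Rintegral => //.
- by apply: integrable_EFin_normr => //; apply: integrable_EFinB => //; exact: integrable_EFinZl.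
- exact: (integrableZl _ eta IH).
move=> r /= rT; rewrite -mulrBl normrM (ger0_norm (hat_ge0 a r e0)).
have [re|re] := ltP `|r - a| e; last by rewrite hat_out// !mulr0.
by rewrite ler_wpM2r ?hat_ge0// hc.
Qed.

(* The test functions th n converge to the indicator of ]s, t[. *)
Lemma weak_primitive h k :
  (forall t : R, t \in `[0, T] -> continuous_on_at h t) ->
  lam.-integrable `[0, T] (EFin \o k) ->
  (forall th, time_test T th -> \int[lam]_(r in `[0, T]) (h r * derive1 th r) =
     - \int[lam]_(r in `[0, T]) (k r * th r)) ->
  forall s t : R, 0 <= s -> s < t -> t <= T ->
    h t - h s = \int[lam]_(r in `[s, t]) k r.
Proof.
move=> ch Ik weak s t s0 st tT.
have wh := continuous_on_within ch.
(* The ramps have half-width e n and centres s + 2 e n and t - 2 e n. The 8 keeps them disjoint, and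
   the shift by 2 e n keeps them inside ]s, t[, so that the support is compact in ]0, T[ even when s
   = 0 or t = T. *)
pose e (n : nat) : R := (t - s) / 8 * n.+1%:R^-1.
have ts8 : 0 < (t - s) / 8 by rewrite divr_gt0// subr_gt0.
have e0 n : 0 < e n by rewrite mulr_gt0 ?invr_gt0.
have e8 n : e n <= (t - s) / 8.
  by rewrite ler_piMr ?(ltW ts8)// invf_le1// ler1n.
have ecvg : e @ \oo --> (0 : R).
  rewrite -[X in _ --> X](mulr0 ((t - s) / 8)); apply: cvgM; first exact: cvg_cst.
  exact: cvg_harmonic.
pose th n r := smoothstep (s + 2 * e n) (e n) r - smoothstep (t - 2 * e n) (e n) r.
have dth n (r : R) : is_derive r (1 : R) (th n) (hat (s + 2 * e n) (e n) r - hat (t - 2 * e n) (e n) r).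
  by apply: is_deriveB; exact: is_derive_smoothstep.
have thE n : derive1 (th n) = fun r => hat (s + 2 * e n) (e n) r - hat (t - 2 * e n) (e n) r.
  by apply/funext => r; rewrite derive1E; have /@derive_val -> := dth n r.
have tth n : time_test T (th n).
  split.
  - by move=> r; have [] := dth n r.
  - by rewrite thE => r; apply: cvgB; exact: continuous_hat.
  - have := e0 n; have := e8 n => en8 en0.
    exists (s + e n), (t - e n); split; [lra|lra|move=> r].
    rewrite in_itv/= negb_and -!ltNge => /orP[h1|h1].
      by rewrite /th !smoothstep_le ?subrr//; lra.
    by rewrite /th !smoothstep_ge ?subrr//; lra.
have th01 n r : 0 <= th n r <= 1.
  have := e0 n; have := e8 n => en8 en0.
  have [h1|h1] := leP r (t - 3 * e n).
    rewrite /th (@smoothstep_le _ (t - 2 * e n)) ?subr0; [|by []|lra].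
    exact: smoothstep_ge0_le1.
  rewrite /th (@smoothstep_ge _ (s + 2 * e n)); [|by []|lra].
  by have /andP[] := smoothstep_ge0_le1 (t - 2 * e n) r en0; lra.
have L1 : (fun n => \int[lam]_(r in `[0, T]) (h r * derive1 (th n) r)) @ \oo --> h s - h t.
  apply/cvgrPdist_le => eta eta0.
  have eta2 : 0 < eta / 2 by rewrite divr_gt0.
  have sT : s \in `[0, T] by rewrite in_itv/=; apply/andP; split; lra.
  have tT' : t \in `[0, T] by rewrite in_itv/=; apply/andP; split; lra.
  have [d1 d10 hd1] := ch s sT _ eta2; have [d2 d20 hd2] := ch t tT' _ eta2.
  near=> n.
  have := e0 n; have := e8 n => en8 en0.
  (* A point within e n of s + 2 e n is within 3 e n of s; likewise for t. *)
  have ed1 : e n < d1 / 3.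
    near: n; apply: (cvgr_lt _ ecvg); rewrite divr_gt0//.
  have ed2 : e n < d2 / 3.
    near: n; apply: (cvgr_lt _ ecvg); rewrite divr_gt0//.
  rewrite thE.
  have cM a : lam.-integrable `[0, T] (EFin \o (fun r => h r * hat a (e n) r)).
    apply: continuous_itv_integrable => x; apply: continuousM; first exact: wh.
    by apply: continuous_subspaceT => y; exact: continuous_hat.
  under eq_Rintegral do rewrite mulrBr.
  rewrite RintegralB//.
  have H1 : `|\int[lam]_(r in `[0, T]) (h r * hat (s + 2 * e n) (e n) r) - h s| <= eta / 2.
    apply: hat_average => //; [lra|lra|move=> r rT re].
    by apply/ltW/hd1 => //; move: re; rewrite !ltr_norml => /andP[? ?]; apply/andP; split; lra.
  have H2 : `|\int[lam]_(r in `[0, T]) (h r * hat (t - 2 * e n) (e n) r) - h t| <= eta / 2.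
    apply: hat_average => //; [lra|lra|move=> r rT re].
    by apply/ltW/hd2 => //; move: re; rewrite !ltr_norml => /andP[? ?]; apply/andP; split; lra.
  by move: H1 H2; rewrite !ler_norml => /andP[? ?] /andP[? ?]; apply/andP; split; lra.
have mI : measurable (`[0, T]%classic : set (measurableTypeR R)) by exact: measurable_itv.
have mk : measurable_fun (`[0, T]%classic : set (measurableTypeR R)) k.
  by apply/measurable_EFinP; exact: measurable_int Ik.
have cth n : continuous (th n).
  move=> r; apply: differentiable_continuous; apply/derivable1_diffP.
  by have [] := dth n r.
have L2 : (fun n => \int[lam]_(r in `[0, T]) (k r * th n r)) @ \oo -->
    \int[lam]_(r in `[0, T]) (k r * \1_(`]s, t[) r).
  apply: (@dominated_Rintegral _ _ _ lam _ mI (fun n r => k r * th n r)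
    (fun r => k r * \1_(`]s, t[) r) (fun r => `|k r|)).
  - move=> n; apply: measurable_funM => //.
    by apply: measurable_funTS; exact: continuous_measurable_fun.
  - by apply: measurable_funM => //; exact: measurable_indic.
  - move=> r _; apply: cvgM; first exact: cvg_cst.
    rewrite indicE; case: (boolP (r \in `]s, t[%classic)) => [/set_mem|/negP rst].
      rewrite /= in_itv/= => /andP[sr rt].
      apply: cvg_near_cst; near=> n.
      have := e0 n => en0.
      have h1 : e n < (r - s) / 3.
        by near: n; apply: (cvgr_lt _ ecvg); rewrite divr_gt0// subr_gt0.
      have h2 : e n < (t - r) / 3.
        by near: n; apply: (cvgr_lt _ ecvg); rewrite divr_gt0// subr_gt0.
      by rewrite /th smoothstep_ge// ?smoothstep_le// ?subr0//; lra.
    have {}rst : r <= s \/ t <= r.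
      have [|sr] := leP r s; first by left.
      right; rewrite leNgt; apply/negP => rt; apply: rst; apply/mem_set.
      by rewrite /= in_itv/= sr rt.
    apply: cvg_near_cst; near=> n.
    have := e0 n; have := e8 n => en8 en0.
    case: rst => rst; first by rewrite /th !smoothstep_le// ?subrr//; lra.
    by rewrite /th !smoothstep_ge// ?subrr//; lra.
  - exact: integrable_EFin_normr.
  - move=> n r _; rewrite normrM ler_piMr//.
    by have /andP[? ?] := th01 n r; rewrite ger0_norm.
have L2' : \int[lam]_(r in `[0, T]) (k r * \1_(`]s, t[) r) = \int[lam]_(r in `[s, t]) k r.
  rewrite -Rintegral_itv_obnd_cbnd; last first.
    apply: integrableS Ik => //.
    by apply: subset_itv; rewrite bnd_simp; lra.
  rewrite -Rintegral_itv_bndo_bndc; last first.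
    apply: integrableS Ik => //.
    by apply: subset_itv; rewrite bnd_simp; lra.
  rewrite [RHS]Rintegral_mkcond [LHS]Rintegral_mkcond; apply: eq_Rintegral => r _.
  rewrite !patchE indicE; case: ifPn => [rT|]; first by case: ifPn => _; rewrite ?mulr1 ?mulr0.
  case: ifPn => //; rewrite !mem_setE /= !in_itv/= => /andP[sr rt].
  by rewrite (le_trans s0 (ltW sr)) (le_trans (ltW rt) tT).
rewrite L2' in L2.
have : h s - h t = - \int[lam]_(r in `[s, t]) k r.
  rewrite (_ : (fun n => _) = fun n => - \int[lam]_(r in `[0, T]) (k r * th n r)) in L1.
    by apply: (cvg_unique _ L1) => //; exact: cvgN L2.
  by apply/funext => n; exact: weak.
lra.
Unshelve. all: by end_near. Qed.

End weak_primitive.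
Section inner_in_time.
Context {R : realType} {d : nat}.
Variables (Om : set 'rV[R]_d) (T : R).
Hypothesis oOm : open Om.
Local Notation E := 'rV[R]_d.
Local Notation mu := (@lebesgue_rV R d).
Local Notation lam := (@lebesgue_measure R).
Local Notation I0T := (`[0, T]%classic : set (measurableTypeR R)).
Implicit Types (v g e : R -> E -> R) (z : E -> R).

Let mOm : measurable Om := measurable_open oOm.
Let mI : measurable I0T := measurable_itv _.
Let mST : measurable (spacetime Om T) := measurableX mI mOm.

Let slice_integral v (t : R) : t \in `[0, T] ->
  fubini_F mu ((fun p => ((v p.1 p.2) ^+ 2)%:E) \_ (spacetime Om T)) t =
  (\int[mu]_(x in Om) ((v t x) ^+ 2)%:E)%E.
Proof.
move=> tT; rewrite /fubini_F [RHS]integral_mkcond; apply: eq_integral => x _.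
by rewrite !patchE /spacetime in_setX (mem_set (tT : [set` `[0, T]] t)).
Qed.

Let slice_measurable v : measurable_fun (spacetime Om T) (fun p => v p.1 p.2) ->
  measurable_fun setT ((fun p => ((v p.1 p.2) ^+ 2)%:E) \_ (spacetime Om T)).
Proof.
move=> mv; apply/(measurable_restrictT _ mST)/measurable_EFinP.
exact: measurable_funX.
Qed.

Let slice_ge0 v p : (0 <= ((fun p => ((v p.1 p.2) ^+ 2)%:E) \_ (spacetime Om T)) p)%E.
Proof. by apply: erestrict_ge0 => q _; rewrite lee_fin sqr_ge0. Qed.

(** Tonelli for the square. Slices of infinite norm do no harm: [inner] applies [fine], which is
    measurable. *)
Lemma measurable_inner_sqr v : measurable_fun (spacetime Om T) (fun p => v p.1 p.2) ->
  measurable_fun I0T (fun t => inner Om (v t) (v t)).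
Proof.
move=> mv.
have mF := measurable_fun_fubini_tonelli_F (m2 := mu) _ (slice_measurable mv) (slice_ge0 v).
apply: (eq_measurable_fun (fun t => fine (fubini_F mu
    ((fun p => ((v p.1 p.2) ^+ 2)%:E) \_ (spacetime Om T)) t))).
  move=> t /set_mem tT; rewrite slice_integral// /inner /Rintegral; congr fine.
by apply: measurable_funTS; apply: measurableT_comp.
Qed.

Lemma integrable_inner_sqr g : L2L2 Om T g ->
  lam.-integrable `[0, T] (EFin \o (fun t => inner Om (g t) (g t))).
Proof.
move=> [Lg mg gfin]; apply/integrableP; split.
  by apply/measurable_EFinP; exact: measurable_inner_sqr mg.
have mF := measurable_fun_fubini_tonelli_F (m2 := mu) _ (slice_measurable mg) (slice_ge0 g).
apply: le_lt_trans gfin.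
rewrite [leRHS]integral_mkcond (fubini_tonelli1 _ (slice_measurable mg) (slice_ge0 g)).
apply: (@le_trans _ _ (\int[lam]_(t in `[0%R, T]) fubini_F mu
    ((fun p => ((g p.1 p.2) ^+ 2)%:E) \_ (spacetime Om T)) t)%E); last first.
  apply: ge0_subset_integral => //.
  by move=> t _; apply: integral_ge0 => x _; exact: slice_ge0.
rewrite le_eqVlt; apply/orP; left; apply/eqP; apply: eq_integral => t /set_mem tT.
rewrite slice_integral// gee0_abs ?lee_fin ?inner_ge0//= /inner /Rintegral.
have [mgt gt] := Lg t tT.
under eq_integral do rewrite -expr2.
by rewrite fineK// ge0_fin_numE// integral_ge0// => x _; rewrite lee_fin sqr_ge0.
Qed.

Lemma measurable_spacetime_snd z : measurable_fun Om z ->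
  measurable_fun (spacetime Om T) (fun p => z p.2).
Proof.
move=> mz; apply: (measurable_comp mOm _ mz); last exact: measurable_funTS.
by move=> _ [[t x] [_ Omx] <-].
Qed.

Lemma inner_polarization (v z : E -> R) : L2 Om v -> L2 Om z ->
  inner Om v z = 2^-1 * (inner Om (v \+ z) (v \+ z) - inner Om v v - inner Om z z).
Proof.
move=> Lv Lz; have Lvz := L2D oOm Lv Lz.
rewrite innerDl// (innerC _ v (v \+ z)) (innerC _ z (v \+ z)) !innerDl// (innerC _ z v).
by field.
Qed.

(** Polarization reduces the claim to squares, which are nonnegative and so within the reach of
    Tonelli. *)
Lemma measurable_inner v z : (forall t : R, t \in `[0, T] -> L2 Om (v t)) ->
  measurable_fun (spacetime Om T) (fun p => v p.1 p.2) -> L2 Om z ->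
  measurable_fun I0T (fun t => inner Om (v t) z).
Proof.
move=> Lv mv Lz.
apply: (eq_measurable_fun (fun t => 2^-1 * (inner Om (v t \+ z) (v t \+ z) -
    inner Om (v t) (v t) - inner Om z z))).
  by move=> t /set_mem tT; rewrite [RHS]inner_polarization//; exact: Lv.
apply: measurable_funM => //; apply: measurable_funB => //.
apply: measurable_funB; last exact: measurable_inner_sqr.
apply: (@measurable_inner_sqr (fun t => v t \+ z)).
by apply: measurable_funD => //; apply: measurable_spacetime_snd; case: Lz.
Qed.

Lemma integrable_cst_I0T (c : R) : lam.-integrable `[0, T] (EFin \o (fun=> c)).
Proof.
apply: continuous_itv_integrable; apply: continuous_subspaceT => x.
exact: cvg_cst.
Qed.

Lemma inner_le_sum (v z : E -> R) : L2 Om v -> L2 Om z ->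
  `|inner Om v z| <= inner Om v v + inner Om z z.
Proof.
move=> Lv Lz; apply: le_trans (inner_Cauchy_Schwarz oOm Lv Lz) _.
rewrite -!sqr_L2norm; have := sqrtr_ge0 (inner Om v v); have := sqrtr_ge0 (inner Om z z).
by rewrite -/(L2norm _ _) -/(L2norm _ _); nra.
Qed.

Lemma integrable_inner g z : L2L2 Om T g -> L2 Om z ->
  lam.-integrable `[0, T] (EFin \o (fun t => inner Om (g t) z)).
Proof.
move=> Lg Lz; have [Lgt mg _] := Lg.
apply: (@le_integrable_EFin _ _ _ lam _ mI _
    (fun t => inner Om (g t) (g t) + inner Om z z)).
- exact: measurable_inner.
- apply: integrable_EFinD => //; first exact: integrable_inner_sqr.
  exact: integrable_cst_I0T.
- by move=> t tT; apply: inner_le_sum => //; exact: Lgt.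
Qed.

Lemma L2L2_lincomb c g v : L2L2 Om T g -> L2L2 Om T v ->
  L2L2 Om T (fun t => c \*o g t \+ v t).
Proof.
move=> [Lg mg gfin] [Lv mv vfin].
have [m s] := sqint_lincomb mST c (conj mg gfin) (conj mv vfin).
by split=> // t tT; apply: L2_lincomb => //; [exact: Lg|exact: Lv].
Qed.

End inner_in_time.

(** * The energy identity *)

Section energy_identity.
Context {R : realType} {d : nat}.
Variables (Om : set 'rV[R]_d) (T : R).
Hypotheses (oOm : open Om) (T0 : 0 < T).
Local Notation E := 'rV[R]_d.
Local Notation mu := (@lebesgue_rV R d).
Local Notation lam := (@lebesgue_measure R).
Local Notation I0T := (`[0, T]%classic : set (measurableTypeR R)).
Variables e g : R -> E -> R.
Hypotheses (Le : forall t : R, t \in `[0, T] -> L2 Om (e t))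
  (ce : forall t : R, t \in `[0, T] -> time_continuous_at T (L2norm Om) e t)
  (eg : time_derivative Om T e g).

Let Lg : L2L2 Om T g := eg.1.
Let Lgt (t : R) : t \in `[0, T] -> L2 Om (g t).
Proof. by case: Lg => + _ _; exact. Qed.

Lemma continuous_on_inner z : L2 Om z -> forall t : R, t \in `[0, T] ->
  continuous_on_at T (fun t => inner Om (e t) z) t.
Proof.
move=> Lz t tT eps eps0; have z1 : 0 < L2norm Om z + 1.
  by rewrite ltr_wpDl// sqrtr_ge0.
have [|del del0 H] := ce tT (_ : 0 < eps / (L2norm Om z + 1)); first by rewrite divr_gt0.
exists del => // s sT st; rewrite -innerBl//; [|exact: Le|exact: Le].
apply: le_lt_trans (inner_Cauchy_Schwarz oOm _ Lz) _; first by apply: L2B => //; exact: Le.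
have := H s sT st; rewrite ltr_pdivlMr//; apply: le_lt_trans.
by rewrite ler_wpM2l ?sqrtr_ge0// lerDl.
Qed.

(** For fixed z the vector-valued weak derivative becomes a scalar one, and [weak_primitive]
    applies. *)
Lemma inner_increment z (s t : R) : L2 Om z -> 0 <= s -> s < t -> t <= T ->
  inner Om (e t) z - inner Om (e s) z = \int[lam]_(r in `[s, t]) inner Om (g r) z.
Proof.
move=> Lz; apply: (@weak_primitive R T T0 (fun t => inner Om (e t) z) (fun t => inner Om (g t) z)).
- exact: continuous_on_inner.
- exact: integrable_inner.
- by move=> th tth; have [_] := eg; apply.
Qed.

Lemma L2norm_bounded : exists M, forall t : R, t \in `[0, T] -> L2norm Om (e t) <= M.
Proof.
have [|c _ cM] := @EVT_max R (fun t => L2norm Om (e t)) 0 T (ltW T0).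
  apply: continuous_on_within => // t tT eps eps0.
  have [del del0 H] := ce tT eps0; exists del => // s sT st.
  have Les := Le sT; have Let_ := Le tT.
  apply: le_lt_trans (H s sT st).
  have A : L2norm Om (e s) <= L2norm Om (e s \- e t) + L2norm Om (e t).
    rewrite -[in leLHS](_ : (e s \- e t) \+ e t = e s); last first.
      by apply/funext => x /=; rewrite subrK.
    by apply: L2norm_triangle => //; exact: L2B.
  have B : L2norm Om (e t) <= L2norm Om (e s \- e t) + L2norm Om (e s).
    rewrite (_ : L2norm Om (e s \- e t) = L2norm Om (e t \- e s)); last first.
      rewrite /L2norm; congr Num.sqrt; apply: eq_Rintegral => x _ /=; ring.
    rewrite -[in leLHS](_ : (e t \- e s) \+ e s = e t); last first.
      by apply/funext => x /=; rewrite subrK.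
    by apply: L2norm_triangle => //; exact: L2B.
  by rewrite ler_norml; apply/andP; split; lra.
by exists (L2norm Om (e c)).
Qed.

(* step n approximates 2 <g, e> on the uniform grid with n.+1 intervals. *)
Let node n k : R := T * (k%:R / n.+1%:R).
Let idx n (t : R) : nat := Num.truncn (t / T * n.+1%:R).
Let step n t := inner Om (g t) (e (node n (idx n t)) \+ e (node n (idx n t).+1)).

Let node0 n : node n 0 = 0.
Proof. by rewrite /node mul0r mulr0. Qed.

Let nodeT n : node n n.+1 = T.
Proof. by rewrite /node divff ?mulr1// pnatr_eq0. Qed.

Let node_lt n k l : (k < l)%N -> node n k < node n l.
Proof. by move=> kl; rewrite /node ltr_pM2l// ltr_pM2r ?invr_gt0// ltr_nat. Qed.

Let node_le n k l : (k <= l)%N -> node n k <= node n l.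
Proof. by move=> kl; rewrite /node ler_pM2l// ler_pM2r ?invr_gt0// ler_nat. Qed.

Let node_mem n k : (k <= n.+1)%N -> node n k \in `[0, T].
Proof.
move=> kn; have := node_le n (leq0n k); have := node_le n kn.
by rewrite node0 nodeT in_itv/= => -> ->.
Qed.

Let idxP n k (t : R) : node n k <= t < node n k.+1 -> idx n t = k.
Proof.
move=> /andP[kt tk]; apply: truncn_def; rewrite -ler_pdivrMr// -ltr_pdivlMr//.
by rewrite ler_pdivlMr// ltr_pdivrMr// ![_ * T]mulrC kt tk.
Qed.

(** The endpoint T is excluded because its index is n.+1 and the following node would leave
    [0, T]. *)
Let idx_bounds n (t : R) : t \in `[0, T[ ->
  [/\ (idx n t < n.+1)%N, node n (idx n t) <= t & t < node n (idx n t).+1].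
Proof.
rewrite in_itv/= => /andP[t0 tT].
have tT0 : 0 <= t / T * n.+1%:R by rewrite mulr_ge0// divr_ge0// ltW.
have /andP[i1 i2] := truncn_itv tT0.
split.
- rewrite -(ltr_nat R); apply: le_lt_trans i1 _.
  by rewrite gtr_pMl// ltr_pdivrMr// mul1r.
- by rewrite /node mulrC -ler_pdivlMr// ler_pdivrMr.
- by rewrite /node mulrC -ltr_pdivrMr// ltr_pdivlMr.
Qed.

Let Lsum (s t : R) : s \in `[0, T] -> t \in `[0, T] -> L2 Om (e s \+ e t).
Proof. by move=> sT tT; apply: L2D => //; exact: Le. Qed.

(** From 2 M ||g|| <= ||g||^2 + M^2: an integrable majorant of [step n] that does not depend on
    n. *)
Let bound M (t s r : R) : t \in `[0, T] -> s \in `[0, T] -> r \in `[0, T] ->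
  (forall t : R, t \in `[0, T] -> L2norm Om (e t) <= M) ->
  `|inner Om (g t) (e s \+ e r)| <= inner Om (g t) (g t) + M ^+ 2.
Proof.
move=> tT sT rT eM.
apply: le_trans (inner_Cauchy_Schwarz oOm (Lgt tT) (Lsum sT rT)) _.
have := L2norm_triangle oOm (Le sT) (Le rT); have := eM _ sT; have := eM _ rT.
rewrite -sqr_L2norm; have := sqrtr_ge0 (inner Om (g t) (g t)).
rewrite -/(L2norm _ _); have := sqrtr_ge0 (inner Om (e s) (e s)).
rewrite -/(L2norm _ (e s)).
rewrite -/(L2norm Om (e s)).
move: (L2norm Om (g t)) (L2norm Om (e s)) (L2norm Om (e r)) (L2norm Om _) => x a b c *.
have : x * c <= x * (M + M) by rewrite ler_wpM2l//; lra.
by have := sqr_ge0 (x - M); nra.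
Qed.

Let integrable_bound (M : R) (A : set (measurableTypeR R)) (h : R -> R) :
  measurable A -> A `<=` I0T -> measurable_fun A h ->
  (forall t, A t -> `|h t| <= inner Om (g t) (g t) + M ^+ 2) ->
  lam.-integrable A (EFin \o h).
Proof.
move=> mA AI mh hM.
apply: (@le_integrable_EFin _ _ _ lam _ mA _ (fun t => inner Om (g t) (g t) + M ^+ 2)) => //.
apply: (@integrableS _ _ _ lam I0T) => //.
apply: integrable_EFinD => //; first exact: integrable_inner_sqr.
exact: integrable_cst_I0T.
Qed.

(* On each interval of the grid, ||e'||^2 - ||e||^2 = <e' - e, e' + e>. *)
Let step_integral n k : (k <= n.+1)%N ->
  measurable_fun (`[0, node n k[%classic : set (measurableTypeR R)) (step n) /\
  \int[lam]_(t in `[0, node n k[) step n t =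
    inner Om (e (node n k)) (e (node n k)) - inner Om (e 0) (e 0).
Proof.
have [M eM] := L2norm_bounded.
elim: k => [_|k IH kn].
  rewrite node0 subrr set_itv_ge ?bnd_simp ?ltxx//; split; first exact: measurable_fun_set0.
  exact: Rintegral_set0.
have [mk Ik] := IH (ltnW kn).
have kT := node_mem (ltnW kn); have k1T := node_mem kn.
have k0 : 0 <= node n k by move: kT; rewrite in_itv/= => /andP[].
have kk1 := node_lt n (ltnSn k).
(* On one cell the second argument of [step n] is this fixed element, as [inner_increment]
   requires. *)
pose z := e (node n k) \+ e (node n k.+1).
have stepE : {in `[node n k, node n k.+1[%classic, (fun t => inner Om (g t) z) =1 step n}.
  by move=> t /set_mem/=; rewrite in_itv/= => /idxP; rewrite /step => ->.
have k1sub : `[node n k, node n k.+1[%classic `<=` I0T.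
  apply: subset_itv; rewrite bnd_simp//.
  by move: k1T; rewrite in_itv/= => /andP[].
have Iz : lam.-integrable `[node n k, node n k.+1[ (EFin \o (fun t => inner Om (g t) z)).
  by apply: (@integrableS _ _ _ lam I0T) => //; apply: integrable_inner => //; exact: Lsum.
have ms : measurable_fun (`[node n k, node n k.+1[%classic : set (measurableTypeR R)) (step n).
  apply: eq_measurable_fun stepE _.
  by apply/measurable_EFinP; exact: measurable_int Iz.
have splitE : `[0, node n k.+1[%classic = `[0, node n k[%classic `|` `[node n k, node n k.+1[%classic.
  by apply: itv_bndbnd_setU; rewrite bnd_simp// ltW.
have m1 : measurable_fun (`[0, node n k.+1[%classic : set (measurableTypeR R)) (step n).
  by rewrite splitE; apply/measurable_funU.
split=> //.
have Istep : lam.-integrable `[0, node n k.+1[ (EFin \o step n).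
  apply: (@integrable_bound M) => //.
    apply: subset_itvl; rewrite bnd_simp.
    by move: k1T; rewrite in_itv/= => /andP[].
  move=> t /= tk.
  have tT : t \in `[0, T[.
    move: tk k1T; rewrite !in_itv/= => /andP[-> /lt_le_trans +] /andP[_ k1]; exact.
  have [i1 _ _] := idx_bounds n tT.
  by apply: bound => //; [exact: subset_itv_co_cc|exact/node_mem/ltnW|exact: node_mem].
rewrite splitE Rintegral_setU//; last 2 first.
- by rewrite -splitE.
- apply/disj_setPS => t [] /=; rewrite !in_itv/= => /andP[_ tk] /andP[kt _].
  by have := lt_le_trans tk kt; rewrite ltxx.
rewrite Ik (_ : \int[lam]_(x in `[node n k, node n k.+1[) step n x =
    \int[lam]_(x in `[node n k, node n k.+1[) inner Om (g x) z); last first.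
  by apply: eq_Rintegral => t tk; rewrite stepE.
rewrite Rintegral_itv_bndo_bndc//.
rewrite -inner_increment//; [|exact: Lsum|by move: k1T; rewrite in_itv/= => /andP[]].
have Lk := Le kT; have Lk1 := Le k1T.
rewrite (innerC _ _ z) (innerC _ (e (node n k)) z) !innerDl//.
rewrite (innerC _ (e (node n k.+1)) (e (node n k))).
by ring.
Qed.

(** The integral of [step n] over [0, T[ telescopes to the same value for every n, while [step n]
    tends to 2 <g, e> pointwise because e is continuous into L_2. *)
Lemma energy_identity :
  lam.-integrable `[0, T] (EFin \o (fun t => inner Om (g t) (e t))) /\
  2 * \int[lam]_(t in `[0, T]) inner Om (g t) (e t) =
    inner Om (e T) (e T) - inner Om (e 0) (e 0).
Proof.
have [M eM] := L2norm_bounded.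
have mIo : measurable (`[0, T[%classic : set (measurableTypeR R)) by exact: measurable_itv.
have subI : `[0, T[%classic `<=` I0T by exact: subset_itv_co_cc.
have step_cvg (t : R) : t \in `[0, T[ -> (fun n => step n t) @ \oo --> 2 * inner Om (g t) (e t).
  move=> tT; have tT' := subset_itv_co_cc tT.
  apply/cvgrPdist_le => eps eps0.
  have G0 : 0 <= L2norm Om (g t) := sqrtr_ge0 _.
  have eG : 0 < eps / (2 * (L2norm Om (g t) + 1)) by rewrite divr_gt0// mulr_gt0// ltr_wpDl.
  have [del del0 H] := ce tT' eG.
  near=> n.
  have [i1 i2 i3] := idx_bounds n tT.
  have small : T / n.+1%:R < del.
    rewrite ltr_pdivrMr// mulrC -ltr_pdivrMr//; near: n.
    have [m _ hm] := nbhs_infty_gtr (T / del).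
    by exists m => // k /= mk; apply: lt_trans (hm k mk) _; rewrite ltr_nat.
  have gap : node n (idx n t).+1 - node n (idx n t) = T / n.+1%:R.
    by rewrite /node -mulrBr -mulrBl -natr1 addrAC subrr add0r mul1r.
  have n1T := node_mem (ltnW i1); have n2T := node_mem i1.
  have h1 := H _ n1T; rewrite distrC ger0_norm ?subr_ge0// in h1.
  have {}h1 : L2norm Om (e (node n (idx n t)) \- e t) < eps / (2 * (L2norm Om (g t) + 1)).
    by apply: h1; apply: le_lt_trans small; rewrite -gap lerD2r ltW.
  have h2 := H _ n2T; rewrite ger0_norm ?subr_ge0 ?ltW// in h2.
  have {}h2 : L2norm Om (e (node n (idx n t).+1) \- e t) < eps / (2 * (L2norm Om (g t) + 1)).
    by apply: h2; apply: le_lt_trans small; rewrite -gap lerD2l lerN2.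
  have L1 := Le n1T; have L2' := Le n2T; have Lt := Le tT'; have LG := Lgt tT'.
  rewrite /step distrC.
  have -> : inner Om (g t) (e (node n (idx n t)) \+ e (node n (idx n t).+1)) - 2 * inner Om (g t) (e t) =
      inner Om (g t) (e (node n (idx n t)) \- e t) + inner Om (g t) (e (node n (idx n t).+1) \- e t).
    by rewrite !(innerC _ (g t)) innerDl// !innerBl//; ring.
  apply: le_trans (ler_normD _ _) _.
  have C1 := inner_Cauchy_Schwarz oOm LG (L2B oOm L1 Lt).
  have C2 := inner_Cauchy_Schwarz oOm LG (L2B oOm L2' Lt).
  apply: le_trans (lerD C1 C2) _; rewrite -mulrDr.
  move: h1 h2; rewrite !ltr_pdivlMr ?mulr_gt0 ?ltr_wpDl//.
  have := sqrtr_ge0 (inner Om (e (node n (idx n t)) \- e t) (e (node n (idx n t)) \- e t)).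
  have := sqrtr_ge0 (inner Om (e (node n (idx n t).+1) \- e t) (e (node n (idx n t).+1) \- e t)).
  rewrite -/(L2norm Om (e (node n (idx n t)) \- e t)) -/(L2norm Om (e (node n (idx n t).+1) \- e t)).
  move: (L2norm Om (g t)) (L2norm Om (e (node n (idx n t)) \- e t))
    (L2norm Om (e (node n (idx n t).+1) \- e t)) G0 => x a b *; nra.
have mstep n : measurable_fun (`[0, T[%classic : set (measurableTypeR R)) (step n).
  by have [] := @step_integral n n.+1 (leqnn _); rewrite nodeT.
have mlim : measurable_fun (`[0, T[%classic : set (measurableTypeR R)) (fun t => 2 * inner Om (g t) (e t)).
  by apply: measurable_fun_cvg mstep _ => t tT; exact: step_cvg.
have mge : measurable_fun I0T (fun t => inner Om (g t) (e t)).
  have -> : I0T = `[0, T[%classic `|` [set T].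
    by rewrite setUitv1// bnd_simp ltW.
  apply/measurable_funU => //; split; last exact: measurable_fun_set1.
  apply: (eq_measurable_fun (fun t => 2^-1 * (2 * inner Om (g t) (e t)))).
    by move=> t _; rewrite mulKf.
  exact: measurable_funM.
have Ige : lam.-integrable `[0, T] (EFin \o (fun t => inner Om (g t) (e t))).
  apply: (@integrable_bound M) => // t tT.
  apply: le_trans (inner_Cauchy_Schwarz oOm (Lgt tT) (Le tT)) _.
  rewrite -sqr_L2norm; have := eM t tT; have := sqrtr_ge0 (inner Om (g t) (g t)).
  have := sqrtr_ge0 (inner Om (e t) (e t)).
  rewrite -/(L2norm Om (e t)) -/(L2norm Om (g t)).
  move: (L2norm Om (g t)) (L2norm Om (e t)) => x a *.
  have : x * a <= x * M by rewrite ler_wpM2l.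
  by have := sqr_ge0 (x - M); have := sqr_ge0 x; nra.
split=> //.
rewrite -Rintegral_itv_bndo_bndc; last exact: integrableS Ige.
rewrite -RintegralZl//; last exact: integrableS Ige.
have L : (fun n => \int[lam]_(t in `[0, T[) step n t) @ \oo -->
    \int[lam]_(t in `[0, T[) (2 * inner Om (g t) (e t)).
  apply: (@dominated_Rintegral _ _ _ lam _ mIo step _
    (fun t => inner Om (g t) (g t) + M ^+ 2)) => //.
    apply: (@integrable_bound M) => //; last first.
      by move=> t _; rewrite ger0_norm// addr_ge0 ?inner_ge0 ?sqr_ge0.
    apply: measurable_funD => //; apply: measurable_funS subI _ => //.
    by apply: measurable_inner_sqr => //; case: Lg.
  move=> n t tT; have [i1 _ _] := idx_bounds n tT.
  by apply: bound => //; [exact: subset_itv_co_cc|exact/node_mem/ltnW|exact: node_mem].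
rewrite (_ : (fun n => _) = fun=> inner Om (e T) (e T) - inner Om (e 0) (e 0)) in L.
  by apply: (cvg_unique _ L) => //; exact: cvg_cst.
by apply/funext => n; have [_] := @step_integral n n.+1 (leqnn _); rewrite nodeT.
Unshelve. all: by end_near. Qed.

End energy_identity.
(** * The estimate in time *)

Section L2time_estimate.
Context {R : realType}.
Variable T : R.
Local Notation lam := (@lebesgue_measure R).
Local Notation I0T := (`[0, T]%classic : set (measurableTypeR R)).
Local Open Scope ereal_scope.

Let mI : measurable I0T := measurable_itv _.

Lemma L2time_ge0 (n : R -> \bar R) : 0 <= L2time T n.
Proof. exact: poweR_ge0. Qed.

Lemma L2time_EFin (f : R -> R) : L2time T (fun t => (f t)%:E) =
  (\int[lam]_(t in `[0%R, T]) ((f t) ^+ 2)%:E) `^ 2^-1.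
Proof. by rewrite /L2time; under eq_integral do rewrite -EFin_expe. Qed.

Lemma L2time_sqint (f : R -> R) : sqint lam I0T f ->
  L2time T (fun t => (f t)%:E) = (Num.sqrt (ip lam I0T f f))%:E.
Proof.
move=> [_ ffin]; rewrite L2time_EFin.
have f0 : 0 <= \int[lam]_(t in `[0%R, T]) ((f t) ^+ 2)%:E.
  by apply: integral_ge0 => t _; rewrite lee_fin sqr_ge0.
have := ge0_fin_numE f0; rewrite ffin => /fineK <-.
by rewrite poweR_EFin powR12_sqrt ?fine_ge0.
Qed.

Lemma L2time_lty (n : R -> \bar R) : L2time T n < +oo ->
  \int[lam]_(t in `[0%R, T]) (n t ^+ 2) < +oo.
Proof.
rewrite /L2time; case: (\int[lam]_(t in `[0%R, T]) (n t ^+ 2)) => [x _||_].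
- by rewrite ltry.
- by rewrite poweRyr// invr_neq0.
- by rewrite ltNye.
Qed.

Lemma sqint_of_L2time (f : R -> R) : measurable_fun I0T f ->
  L2time T (fun t => (f t)%:E) < +oo -> sqint lam I0T f.
Proof.
by move=> mf /L2time_lty; split => //; under eq_integral do rewrite EFin_expe.
Qed.

(** An infinite term makes the right-hand side +oo, nonnegativity excluding a clash with -oo; so the
    norms on the right may be taken finite. *)
Lemma le_weighted_sum (x a b c r : \bar R) : 0 <= a -> 0 <= b -> 0 <= c -> 0 <= r ->
  (a < +oo -> b < +oo -> c < +oo -> x <= 3%:E * a + 2%:E * b + 2%:E * c + r) ->
  x <= 3%:E * a + 2%:E * b + 2%:E * c + r.
Proof.
move=> a0 b0 c0 r0 H.
have M (k y : \bar R) : 0 <= k -> 0 <= y -> k * y != -oo.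
  by move=> k0 y0; rewrite gt_eqF// (lt_le_trans (ltNyr 0)) ?mule_ge0.
have A (y z : \bar R) : 0 <= y -> 0 <= z -> y + z != -oo.
  by move=> k0 y0; rewrite gt_eqF// (lt_le_trans (ltNyr 0)) ?adde_ge0.
have [aoo|] := ltP a +oo; last first.
  rewrite leye_eq => /eqP ->; rewrite gt0_muley ?lte_fin// !addye ?leey//.
  - by rewrite gt_eqF// (lt_le_trans (ltNyr 0)).
  - exact: M.
  - exact: M.
have [boo|] := ltP b +oo; last first.
  rewrite leye_eq => /eqP ->; rewrite gt0_muley ?lte_fin// addey ?addye ?leey ?M//.
  by rewrite gt_eqF// (lt_le_trans (ltNyr 0)).
have [coo|] := ltP c +oo; last first.
  rewrite leye_eq => /eqP ->; rewrite gt0_muley ?lte_fin// addey ?addye ?leey ?A ?mule_ge0//.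
  by rewrite gt_eqF// (lt_le_trans (ltNyr 0)).
exact: H.
Qed.

Lemma ae_time2 (P1 P2 P3 : R -> Prop) :
  (forall t : R, t \in `[0%R, T] -> P1 t -> P2 t -> P3 t) ->
  {ae lam, forall t : R, t \in `[0%R, T] -> P1 t} ->
  {ae lam, forall t : R, t \in `[0%R, T] -> P2 t} ->
  {ae lam, forall t : R, t \in `[0%R, T] -> P3 t}.
Proof.
move=> P123 ae1 ae2.
(* With t in measurableTypeR R, the filter instance of {ae lam, _} is found. *)
have ae1' : {ae lam, forall t, I0T t -> P1 t} := ae1.
have ae2' : {ae lam, forall t, I0T t -> P2 t} := ae2.
suff : {ae lam, forall t, I0T t -> P3 t} by [].
by apply: filterS2 ae1' ae2' => t + + tT => /(_ tT) ? /(_ tT); exact: P123.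
Qed.

(** E is given separately at each time, with no measurability in t. By 2 b E <= b^2 + E^2 with b =
    |H| + W + D, the quadratic inequality bounds it by the root of m = b^2 - 2 q, a measurable
    function with explicit integral. *)
Lemma L2time_estimate (Y W D q : R -> R) (H : R -> \bar R) (c0 cT : R) :
  measurable_fun I0T Y -> measurable_fun I0T W -> measurable_fun I0T D ->
  measurable_fun I0T H ->
  (forall t : R, t \in `[0%R, T] -> (0 <= Y t)%R /\ (0 <= D t)%R) ->
  lam.-integrable `[0%R, T] (EFin \o q) ->
  (2 * \int[lam]_(t in `[0%R, T]) q t = cT - c0)%R -> (0 <= c0)%R -> (0 <= cT)%R ->
  {ae lam, forall t : R, t \in `[0%R, T] -> H t \is a fin_num ->
    exists2 E : R, (Y t <= D t + E)%R &
      (E ^+ 2 <= - q t + (`|fine (H t)| + W t + D t) * E)%R} ->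
  L2time T (fun t => (Y t)%:E) <=
  3%:E * L2time T (fun t => (W t)%:E) + 2%:E * L2time T (fun t => (D t)%:E) +
  2%:E * L2time T H + 2%:E * (Num.sqrt c0)%:E.
Proof.
move=> mY mW mD mH pos Iq qE c00 cT0 est.
apply: le_weighted_sum; try exact: L2time_ge0.
  by rewrite mule_ge0 ?lee_fin ?sqrtr_ge0.
move=> Wfin Dfin Hfin.
have LW := sqint_of_L2time mW Wfin; have LD := sqint_of_L2time mD Dfin.
pose h t := fine (H t).
have mh : measurable_fun I0T h by exact: measurableT_comp.
(* The square is +oo at both infinite values, so its integrability excludes both almost
   everywhere. *)
have Hfinae : {ae lam, forall t, I0T t -> H t \is a fin_num}.
  have : lam.-integrable I0T (fun t => H t ^+ 2).
    apply/integrableP; split.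
      by rewrite (_ : (fun t => _) = H \* H); [exact: emeasurable_funM|apply/funext => t].
    under eq_integral do rewrite gee0_abs ?sqre_ge0//.
    exact: L2time_lty.
  move/(integrable_ae mI); apply: filterS => t /[apply].
  by rewrite expe2; case: (H t).
have hHE : \int[lam]_(t in I0T) (H t ^+ 2) = \int[lam]_(t in I0T) ((h t) ^+ 2)%:E.
  apply: ge0_ae_eq_integral => [t _|t _|]; [exact: sqre_ge0|by rewrite lee_fin sqr_ge0|].
  by apply: filterS Hfinae => t + tT => /(_ tT) Ht; rewrite EFin_expe fineK.
have Lh : sqint lam I0T h by split=> //; rewrite -hHE; exact: L2time_lty.
have HE : L2time T H = (Num.sqrt (ip lam I0T h h))%:E.
  by rewrite -L2time_sqint// L2time_EFin -hHE.
pose nh t : R := `|h t|%R.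
have Lnh : sqint lam I0T nh.
  split; first exact: measurableT_comp.
  by under eq_integral do rewrite /nh real_normK ?num_real//; case: Lh.
have nhE : ip lam I0T nh nh = ip lam I0T h h.
  by apply: eq_Rintegral => t _; rewrite /nh -!expr2 real_normK ?num_real.
pose b := ((nh \+ W) \+ D)%R.
have sqD (v z : R -> R) : sqint lam I0T v -> sqint lam I0T z -> sqint lam I0T (v \+ z)%R.
  move=> Lv Lz; rewrite (_ : v \+ z = 1 \*o v \+ z)%R; first exact: sqint_lincomb.
  by apply/funext => t /=; rewrite mul1r.
have LnhW := sqD _ _ Lnh LW; have Lb : sqint lam I0T b by exact: sqD.
have Ib := sqint_integrable_mul mI Lb Lb.
pose m t : R := (b t * b t - 2 * q t)%R.
have Im : lam.-integrable I0T (EFin \o m).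
  by apply: integrable_EFinB => //; exact: integrable_EFinZl.
have mm : measurable_fun I0T m by apply/measurable_EFinP; exact: measurable_int Im.
(* The estimate gives 0 <= m only almost everywhere; the maximum makes s ^+ 2 equal to the positive
   part of m everywhere. *)
pose s t : R := Num.sqrt (Num.max (m t) 0%R).
have s2 t : (s t ^+ 2 = Num.max (m t) 0)%R by rewrite sqr_sqrtr// le_max lexx orbT.
have estm : {ae lam, forall t, I0T t -> (0 <= m t)%R /\ (Y t <= D t + s t)%R}.
  have est' : {ae lam, forall t, I0T t -> H t \is a fin_num ->
      exists2 E : R, (Y t <= D t + E)%R &
      (E ^+ 2 <= - q t + (`|fine (H t)| + W t + D t) * E)%R} := est.
  apply: filterS2 est' Hfinae => t + + tT => /(_ tT) + /(_ tT) Ht => /(_ Ht)[E YDE E2].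
  have E2m : (E ^+ 2 <= m t)%R.
    rewrite /m /b /nh /=; move: E2; rewrite -/(h t).
    move: (`|h t| + W t + D t)%R => B; have := sqr_ge0 (B - E); nra.
  have m0 : (0 <= m t)%R by apply: le_trans E2m; exact: sqr_ge0.
  split=> //; apply: le_trans YDE _; rewrite lerD2l (le_trans (ler_norm E))//.
  by rewrite -sqrtr_sqr /s max_l// ler_wsqrtr.
have ms : measurable_fun I0T s.
  apply: (measurableT_comp (f := @Num.sqrt R) (g := fun t => Num.max (m t) 0%R)).
    by apply: continuous_measurable_fun; exact: sqrt_continuous.
  exact: measurable_funrpos.
have Ls : sqint lam I0T s.
  split=> //; apply: integrable_lty => //.
  apply: (@le_integrable_EFin _ _ _ lam _ mI (fun t => s t ^+ 2)%R (fun t => `|m t|)%R).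
  - exact: measurable_funX.
  - exact: integrable_EFin_normr.
  - move=> t _; rewrite ger0_norm ?sqr_ge0// s2 ge_max normr_ge0 andbT.
    exact: ler_norm.
have ssE : ip lam I0T s s = (ip lam I0T b b + c0 - cT)%R.
  have -> : (ip lam I0T b b + c0 - cT = \int[lam]_(t in `[0%R, T]) m t)%R.
    rewrite /m RintegralB//; last exact: integrable_EFinZl.
    by rewrite RintegralZl// qE /ip; ring.
  congr fine; apply: ae_eq_integral => //.
  - by apply/measurable_EFinP; exact: measurable_funM.
  - exact/measurable_EFinP.
  - by apply: filterS estm => t + tT => /(_ tT)[m0 _]; rewrite /= -expr2 s2 max_l.
have LDs := sqD _ _ LD Ls.
have YDs : L2time T (fun t => (Y t)%:E) <= L2time T (fun t => (D t + s t)%:E).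
  rewrite !L2time_EFin; apply: gt0_ler_poweR; rewrite ?invr_ge0//.
  - by rewrite in_itv/= leey integral_ge0// => t _; rewrite lee_fin sqr_ge0.
  - by rewrite in_itv/= leey integral_ge0// => t _; rewrite lee_fin sqr_ge0.
  apply: ge0_ae_le_integral => [t _|t _|]; [by rewrite lee_fin sqr_ge0|by rewrite lee_fin sqr_ge0|].
  apply: filterS estm => t + tT => /(_ tT)[_ YDs].
  have [Y0 D0] := pos t tT.
  by rewrite lee_fin lerXn2r// nnegrE// addr_ge0// sqrtr_ge0.
apply: (le_trans YDs); rewrite (L2time_sqint LDs) (L2time_sqint LD) (L2time_sqint LW) HE.
rewrite -!EFinM -!EFinD lee_fin -nhE.
have t1 := sqint_triangle mI LD Ls.
have t2 := sqint_triangle mI LnhW LD.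
have t3 := sqint_triangle mI Lnh LW.
(* The final energy cT is dropped here, using its sign. *)
have t4 : (Num.sqrt (ip lam I0T s s) <= Num.sqrt (ip lam I0T b b) + Num.sqrt c0)%R.
  rewrite -[leRHS]ger0_norm ?addr_ge0 ?sqrtr_ge0// -sqrtr_sqr ler_wsqrtr// ssE.
  rewrite sqrrD !sqr_sqrtr ?ip_ge0//.
  have : (0 <= Num.sqrt (ip lam I0T b b) * Num.sqrt c0)%R by rewrite mulr_ge0 ?sqrtr_ge0.
  by rewrite mulr2n; lra.
have := sqrtr_ge0 (ip lam I0T nh nh); have := sqrtr_ge0 (ip lam I0T W W).
have := sqrtr_ge0 (ip lam I0T D D); have := sqrtr_ge0 c0.
by move: t1 t2 t3 t4; rewrite -/b; lra.
Qed.

End L2time_estimate.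
(** * The estimate at a fixed time *)

Section discrete_space.
Context {R : realType} {d : nat}.
Variables (Om : set 'rV[R]_d) (K : finType) (sh : K -> bool).
Variables (F : K -> 'rV[R]_d -> 'rV[R]_d) (p : nat).
Hypotheses (oOm : open Om) (bOm : bounded_set Om).
Local Notation E := 'rV[R]_d.
Local Notation mu := (@lebesgue_rV R d).
Implicit Types v z : E -> R.

Lemma Ppoly_lincomb b c q q' : @Ppoly R d b p q -> Ppoly b p q' ->
  @Ppoly R d b p (c \*o q \+ q').
Proof.
move=> [a a0 ->] [a' a'0 ->]; exists (fun k => c * a k + a' k).
  by move=> hb k kp; rewrite a0// a'0// mulr0 addr0.
apply/funext => x /=; rewrite mulr_sumr -big_split/=; apply: eq_bigr => k _.
by rewrite mulrDl mulrA.
Qed.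

Lemma DGspace_lincomb c v z : DGspace Om sh F p v -> DGspace Om sh F p z ->
  DGspace Om sh F p (c \*o v \+ z).
Proof.
move=> [Lv vP] [Lz zP]; split; first exact: L2_lincomb.
move=> k; have [q qP vq] := vP k; have [q' q'P zq] := zP k.
exists (c \*o q \+ q'); first exact: Ppoly_lincomb.
by apply: filterS2 vq zq => x + + xk => /(_ xk) /= -> /(_ xk) ->.
Qed.

Lemma DGspace0 : DGspace Om sh F p (fun=> 0).
Proof.
split=> [|k]; first exact: L2_0.
exists (fun=> 0); last by apply: aeW.
exists (fun=> 0) => //; apply/funext => x; rewrite big1// => k' _.
by rewrite mul0r.
Qed.

Lemma DGsum_lincomb c v z : DGsum Om sh F p v -> DGsum Om sh F p z ->
  DGsum Om sh F p (c \*o v \+ z).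
Proof.
move=> [s [h [sP hP ->]]] [s' [h' [s'P h'P ->]]].
exists (c \*o s \+ s'), (c \*o h \+ h'); split.
- exact: DGspace_lincomb.
- exact: H10_lincomb.
- by apply/funext => x /=; ring.
Qed.

Lemma DGsum_H10 v : H10 Om v -> DGsum Om sh F p v.
Proof.
move=> hv; exists (fun=> 0), v; split => //; first exact: DGspace0.
by apply/funext => x /=; rewrite add0r.
Qed.

(** The element z supplies the zero of [H10], as - z + z. *)
Lemma DGsum_DGspace v z : DGspace Om sh F p v -> H10 Om z -> DGsum Om sh F p v.
Proof.
move=> hv hz; exists v, ((-1) \*o z \+ z); split => //; first exact: H10_lincomb.
by apply/funext => x /=; rewrite mulN1r addNr addr0.
Qed.

End discrete_space.

Lemma lincombD1 {R : realType} {V : Type} (v z : V -> R) : v \+ z = 1 \*o v \+ z.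
Proof. by apply/funext => x /=; rewrite mul1r. Qed.

Lemma lincombB1 {R : realType} {V : Type} (v z : V -> R) : v \- z = (-1) \*o z \+ v.
Proof. by apply/funext => x /=; rewrite mulN1r addrC. Qed.

(** Compatibility with almost everywhere equality is not an axiom of [norm_on]; it follows from N v
    <= N (v - z) + N z and definiteness. *)
Lemma norm_on_ae_eq {R : realType} {d : nat} (Om : set 'rV[R]_d)
    (X : ('rV[R]_d -> R) -> Prop) (N : ('rV[R]_d -> R) -> R) v z :
  (forall c v z, X v -> X z -> X (c \*o v \+ z)) -> norm_on Om X N ->
  X v -> X z -> ae_eq_on Om v z -> N v = N z.
Proof.
move=> Xlin [_ N0 _ Ntri].
suff le v' z' : X v' -> X z' -> ae_eq_on Om v' z' -> N v' <= N z'.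
  move=> Xv Xz vz; apply/eqP; rewrite eq_le !le//.
  by apply: filterS vz => x + Omx => /(_ Omx) ->.
move=> Xv Xz vz; have Xvz : X (v' \- z') by rewrite lincombB1; exact: Xlin.
have vE : v' = (v' \- z') \+ z' by apply/funext => x /=; rewrite subrK.
rewrite [in leLHS]vE (le_trans (Ntri _ _ Xvz Xz))//.
rewrite (_ : N (v' \- z') = 0) ?add0r//; apply/N0 => //.
by apply: filterS vz => x + Omx => /(_ Omx) /= ->; rewrite subrr.
Qed.

Section open_sets.
Context {R : realType} {d : nat}.
Local Notation mu := (@lebesgue_rV R d).

(** A nonempty open set contains a nondegenerate rational box, whose measure is a product of
    positive lengths. *)
Lemma open_nonnegligible (A : set 'rV[R]_d) : open A -> A !=set0 -> ~ mu.-negligible A.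
Proof.
move=> oA [x Ax] [N [mN N0 AN]].
have := Ax; rewrite {1}(open_rV_bigcup oA) => -[[q r] /= qrA xqr].
have qr i : map_mx ratr q 0 i < (map_mx ratr r 0 i : R).
  by have /andP[qx xr] := xqr i; exact: lt_trans xr.
have : (mu (rbox (map_mx ratr q) (map_mx ratr r)) <= mu N)%E.
  by apply: le_measure; rewrite ?inE//; [exact: measurable_rbox|exact: subset_trans AN].
rewrite N0 [X in (X <= _)%E]lebesgue_rV_box; last by move=> i; exact: ltW.
rewrite lee_fin leNgt => /negP; apply; apply: prodr_gt0 => i _.
by rewrite subr_gt0.
Qed.

End open_sets.

Lemma ae_forall_fin {dd} {S : measurableType dd} {R : realType}
    (mu : {measure set S -> \bar R}) (K : finType) (P : K -> S -> Prop) :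
  (forall k, {ae mu, forall x, P k x}) -> {ae mu, forall x, forall k, P k x}.
Proof.
move=> aeP; have [k0 _|K0] := pickP (@predT K); last by apply: aeW => x k; have := K0 k.
have aen : {ae mu, forall x, forall n, P (nth k0 (enum K) n) x}.
  exact: ae_foralln.
apply: filterS aen => x Px k; have := Px (index k (enum K)).
by rewrite nth_index// mem_enum.
Qed.

(** * Ellipticity with the constant [alpha_flat] *)

Section alpha.
Context {R : realType} {d : nat}.
Variables (Om : set 'rV[R]_d) (K : finType) (kap : K -> set 'rV[R]_d).
Variable a : 'rV[R]_d -> 'M[R]_d.
Hypotheses (d0 : (0 < d)%N) (oOm : open Om) (Om0 : Om !=set0).
Hypotheses (kapO : forall k, open (kap k)) (kap0 : forall k, kap k !=set0)
  (kapOm : forall k, kap k `<=` Om).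
Local Notation mu := (@lebesgue_rV R d).
Hypothesis cover : mu.-negligible (Om `\` \bigcup_k kap k).
Variable c : R.
Hypotheses (c0 : 0 < c) (ac : {ae mu, forall x, Om x -> symposdef (a x) /\
  forall z, c * dotv z z <= dotv (a x *m z) z}).

Let M k := 'N[mu]_+oo[
              EFin \o ((fun x => opnorm (invmx (sqrtm (a x)))) \_ (kap k))]%E.

(** The definition of the L_oo-norm branches on this condition, and is the essential supremum when
    it holds. *)
Let mu_gt0 : (0 < mu setT)%E.
Proof.
rewrite lt0e measure_ge0 andbT; apply/eqP => mu0.
have : mu.-negligible (setT : set 'rV[R]_d) by exists setT; split.
by apply: open_nonnegligible; [exact: openT|exists 0].
Qed.

Let M_ae k : {ae mu, forall x, kap k x -> ((opnorm (invmx (sqrtm (a x))))%:E <= M k)%E}.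
Proof.
have ge := ess_sup_ge mu (abse \o (EFin \o ((fun x => opnorm (invmx (sqrtm (a x)))) \_ (kap k)))).
rewrite /M unlock mu_gt0; apply: filterS ge => x /= Mx kx.
by apply: le_trans Mx; rewrite lee_fin patchE mem_set// ler_norm.
Qed.

(* Positivity matters: as 0 ^- 2 = 0, a vanishing M k would make alpha_flat vanish. *)
Let M_bounds k : (0 < M k)%E /\ (M k <= ((Num.sqrt c)^-1)%:E)%E.
Proof.
split.
  rewrite ltNge; apply/negP => Mk0; have := open_nonnegligible (@kapO k) (@kap0 k).
  apply; have : {ae mu, forall x, ~ kap k x}.
    apply: filterS2 ac (M_ae k) => x + + kx => /(_ (kapOm kx))[pa ca] /(_ kx) Mx.
    have [/andP[op0 _] _] := opnorm_inv_sqrtm d0 pa c0 ca.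
    by have := le_trans Mx Mk0; rewrite lee_fin leNgt op0.
  by apply: negligibleS => x kx; apply.
rewrite /M unlock mu_gt0; apply/ess_supP.
apply: filterS ac => x acx /=; rewrite lee_fin patchE.
case: ifPn => [/set_mem kx|_]; last by rewrite normr0 invr_ge0 sqrtr_ge0.
have [pa ca] := acx (kapOm kx).
have [/andP[op0 opc] _] := opnorm_inv_sqrtm d0 pa c0 ca.
by rewrite ger0_norm// ltW.
Qed.

Let M_fin k : M k \is a fin_num.
Proof.
have [M0 Mc] := M_bounds k.
by rewrite ge0_fin_numE ?(ltW M0)// (le_lt_trans Mc)// ltry.
Qed.

Let fineM_gt0 k : 0 < fine (M k).
Proof. by have [M0 _] := M_bounds k; rewrite fine_gt0// M0 -ge0_fin_numE ?M_fin ?ltW. Qed.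

Let S := [set (fine (M k)) ^- 2 | k in [set: K]].

Let S_lb : lbound S c.
Proof.
move=> _ [k _ <-]; have [_ Mk] := M_bounds k.
have Mc : fine (M k) <= (Num.sqrt c)^-1 by rewrite -lee_fin fineK.
rewrite -[c]invrK lef_pV2 ?posrE ?invr_gt0 ?exprn_gt0//.
rewrite -(sqr_sqrtr (ltW c0)) -exprVn lerXn2r ?nnegrE ?invr_ge0 ?sqrtr_ge0//.
exact: ltW.
Qed.

Lemma alpha_flat_gt0 : 0 < alpha_flat kap a.
Proof.
(* Without elements, Om would be negligible by the covering property. Nonemptiness keeps [inf] from
   its default value. *)
have S0 : S !=set0.
  apply: contrapT => SE; have := open_nonnegligible oOm Om0; apply.
  apply: negligibleS cover => x Omx; split=> // -[k _ _]; apply: SE.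
  by exists (fine (M k) ^- 2), k.
by apply: lt_le_trans c0 _; apply: (lb_le_inf S0); exact: S_lb.
Qed.

(** Almost every x lies in some element k, where |z| <= M k |sqrt(a) z|, while [alpha_flat] is at
    most (M k)^-2. This is the ellipticity that makes division by sqrt(alpha_flat) in the H^-1 norm
    the right scaling. *)
Lemma alpha_flat_ae : {ae mu, forall x, Om x ->
  forall z, alpha_flat kap a * dotv z z <= dotv (a x *m z) z}.
Proof.
have Mae := ae_forall_fin M_ae.
have cov : {ae mu, forall x, Om x -> exists k, kap k x}.
  apply: negligibleS cover => x /= /not_implyP[Omx nk]; split=> // -[k _ kx].
  by apply: nk; exists k.
apply: filterS3 ac Mae cov => x acx Mx covx Omx z; have [k kx] := covx Omx; have [pa ca] := acx Omx.
have := Mx k kx; rewrite -(fineK (M_fin k)) lee_fin => opM.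
have [_ /(_ z) zop] := opnorm_inv_sqrtm d0 pa c0 ca.
have aS : alpha_flat kap a <= fine (M k) ^- 2.
  by apply: ge_inf; [exists c; exact: S_lb|exists k].
have zM : enorm z <= fine (M k) * enorm (sqrtm (a x) *m z).
  by apply: le_trans zop _; rewrite ler_wpM2r ?sqrtr_ge0.
apply: le_trans (ler_wpM2r (dotvv_ge0 z) aS) _.
rewrite mulrC ler_pdivrMr ?exprn_gt0// -dotv_sqrtm//.
have sq y : dotv y y = enorm y ^+ 2 :> R by rewrite sqr_sqrtr ?dotvv_ge0.
rewrite !sq mulrC -exprMn lerXn2r// nnegrE ?sqrtr_ge0//.
by rewrite mulr_ge0 ?sqrtr_ge0// ltW.
Qed.

End alpha.

(** * The stiffness form and the energy norm *)

Section stiffness_form.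
Context {R : realType} {d : nat}.
Variables (Om : set 'rV[R]_d) (a : 'rV[R]_d -> 'M[R]_d).
Local Notation E := 'rV[R]_d.
Local Notation mu := (@lebesgue_rV R d).
Hypotheses (d0 : (0 < d)%N) (oOm : open Om).
Hypothesis ma : forall i j, measurable_fun Om (fun x => a x i j).
Variables c C : R.
Hypothesis ac : {ae mu, forall x, Om x -> symposdef (a x) /\
  forall z, c * dotv z z <= dotv (a x *m z) z <= C * dotv z z}.
Implicit Types v z : E -> R.

Let mOm : measurable Om := measurable_open oOm.

Lemma measurable_dotv_mul (G G' : E -> 'cV[R]_d) : L2vec Om G -> L2vec Om G' ->
  measurable_fun Om (fun x => dotv (a x *m G x) (G' x)).
Proof.
move=> LG LG'; apply: measurable_sum => i; apply: measurable_funM; last by case: (LG' i).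
under eq_fun do rewrite mxE.
by apply: measurable_sum => j; apply: measurable_funM => //; case: (LG j).
Qed.

Lemma stiffnessC v z : H10 Om v -> H10 Om z ->
  stiffness Om a v z = stiffness Om a z v.
Proof.
move=> /grad_weak_gradient[LG _] /grad_weak_gradient[LG' _].
suff E : (\int[mu]_(x in Om) (dotv (a x *m grad Om v x) (grad Om z x))%:E =
    \int[mu]_(x in Om) (dotv (a x *m grad Om z x) (grad Om v x))%:E)%E.
  by rewrite /stiffness /Rintegral E.
apply: ae_eq_integral => //.
- by apply/measurable_EFinP; exact: measurable_dotv_mul.
- by apply/measurable_EFinP; exact: measurable_dotv_mul.
apply: filterS ac => x + Omx => /(_ Omx)[[sa _] _].
by rewrite dotv_mulmxl sa dotvC.
Qed.

Let energy_integral v : H10 Om v ->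
  (\int[mu]_(x in Om) (dotv (sqrtm (a x) *m grad Om v x) (sqrtm (a x) *m grad Om v x))%:E =
  \int[mu]_(x in Om) (dotv (a x *m grad Om v x) (grad Om v x))%:E)%E.
Proof.
move=> /grad_weak_gradient[LG _]; have mG := measurable_dotv_mul LG LG.
(* The absolute value bridges two comparison lemmas: the first needs nonnegativity everywhere but no
   measurability of the root, the second needs measurability but no sign. *)
transitivity (\int[mu]_(x in Om) `|dotv (a x *m grad Om v x) (grad Om v x)|%:E)%E.
  apply: ge0_ae_eq_integral => [x _|x _|]; [by rewrite lee_fin dotvv_ge0|by rewrite lee_fin|].
  apply: filterS ac => x + Omx => /(_ Omx)[pa _].
  by rewrite dotv_sqrtm// ger0_norm// -dotv_sqrtm// dotvv_ge0.
apply: ae_eq_integral => //.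
- by apply/measurable_EFinP; exact: measurableT_comp.
- by apply/measurable_EFinP.
apply: filterS ac => x + Omx => /(_ Omx)[pa _].
by rewrite ger0_norm// -dotv_sqrtm// dotvv_ge0.
Qed.

Lemma sqr_energy_norm v : H10 Om v -> energy_norm Om a v ^+ 2 = stiffness Om a v v.
Proof.
move=> hv; rewrite sqr_sqrtr; last by apply: Rintegral_ge0 => x _; exact: dotvv_ge0.
by rewrite /stiffness /Rintegral energy_integral.
Qed.

(** The lower bound scales the H^-1 norm; the upper one shows that a function with vanishing
    gradient norm has vanishing energy norm, and also that the energy integral is finite. The
    absolute value of C keeps the majorant nonnegative. *)
Lemma energy_norm_bounds (alpha : R) v : 0 <= alpha ->
  {ae mu, forall x, Om x -> forall y, alpha * dotv y y <= dotv (a x *m y) y} ->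
  H10 Om v ->
  alpha * L2vnorm Om (grad Om v) ^+ 2 <= energy_norm Om a v ^+ 2 <=
    `|C| * L2vnorm Om (grad Om v) ^+ 2.
Proof.
move=> alpha0 aa hv; have [LG _] := grad_weak_gradient hv.
have IG := dotv_L2vec_integrable oOm LG LG.
rewrite /energy_norm /L2vnorm !sqr_sqrtr; try by apply: Rintegral_ge0 => x _; exact: dotvv_ge0.
set I := (\int[mu]_(x in Om) (dotv (sqrtm (a x) *m grad Om v x) (sqrtm (a x) *m grad Om v x))%:E)%E.
have I0 : (0 <= I)%E by apply: integral_ge0 => x _; rewrite lee_fin dotvv_ge0.
have le1 : ((alpha * \int[mu]_(x in Om) dotv (grad Om v x) (grad Om v x))%:E <= I)%E.
  rewrite -RintegralZl// /Rintegral fineK; last first.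
    exact: integrable_fin_num (integrable_EFinZl mOm alpha IG).
  apply: ge0_ae_le_integral => [x _|x _|]; rewrite ?lee_fin ?dotvv_ge0//.
    by rewrite mulr_ge0// dotvv_ge0.
  apply: filterS2 ac aa => x + + Omx => /(_ Omx)[pa _] /(_ Omx) ax.
  by rewrite lee_fin dotv_sqrtm.
have le2 : (I <= (`|C| * \int[mu]_(x in Om) dotv (grad Om v x) (grad Om v x))%:E)%E.
  rewrite -RintegralZl// /Rintegral fineK; last first.
    exact: integrable_fin_num (integrable_EFinZl mOm `|C| IG).
  apply: ge0_ae_le_integral => [x _|x _|]; rewrite ?lee_fin ?dotvv_ge0//.
    by rewrite mulr_ge0// dotvv_ge0.
  apply: filterS ac => x + Omx => /(_ Omx)[pa /(_ (grad Om v x))/andP[_ aC]].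
  rewrite lee_fin dotv_sqrtm// (le_trans aC)// ler_wpM2r ?dotvv_ge0//.
  exact: ler_norm.
have Ifin : I \is a fin_num by rewrite ge0_fin_numE// (le_lt_trans le2)// ltry.
by rewrite -!lee_fin (fineK Ifin) le1 le2.
Qed.

End stiffness_form.

(** * From the elliptic reconstruction to the error inequality *)

Section fixed_time.
Context {R : realType} {d : nat}.
Variables (Om : set 'rV[R]_d) (K : finType) (sh : K -> bool).
Variables (F : K -> 'rV[R]_d -> 'rV[R]_d) (p : nat).
Hypotheses (oOm : open Om) (bOm : bounded_set Om).
Local Notation E := 'rV[R]_d.
Local Notation mu := (@lebesgue_rV R d).
Local Notation X := (DGsum Om sh F p).
Local Notation S := (DGspace Om sh F p).
Variables (b : (E -> R) -> (E -> R) -> R) (nrm : (E -> R) -> R).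
Hypotheses (hb : bilinear_form_on Om X b) (hn : norm_on Om X nrm).
Hypotheses (bC : forall v z, H10 Om v -> H10 Om z -> b v z = b z v)
  (b_nrm : forall v, H10 Om v -> b v v = nrm v ^+ 2).
Variables (al C : R).
Hypotheses (al0 : 0 < al) (coer : forall v, H10 Om v ->
  al * L2vnorm Om (grad Om v) ^+ 2 <= nrm v ^+ 2 <= `|C| * L2vnorm Om (grad Om v) ^+ 2).
Variables (f U dU u du w Uc Ud dUd PF AU : E -> R).
Hypotheses (Lf : L2 Om f) (SU : S U) (SdU : S dU) (Hu : H10 Om u) (Ldu : L2 Om du)
  (Hw : H10 Om w) (HUc : H10 Om Uc) (SUd : S Ud) (LdUd : L2 Om dUd)
  (UE : ae_eq_on Om U (Uc \+ Ud)).
Hypotheses (SPF : S PF) (PFE : forall V, S V -> inner Om PF V = inner Om f V)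
  (SAU : S AU) (AUE : forall V, S V -> inner Om AU V = b U V)
  (scheme : forall V, S V -> inner Om dU V + b U V = inner Om f V)
  (recon : forall v, H10 Om v -> b w v = inner Om (AU \- PF \+ f) v)
  (weak : forall v, H10 Om v -> inner Om du v + b u v = inner Om f v).

Let Xlin := DGsum_lincomb (sh := sh) (F := F) (p := p) oOm bOm.
Let Hlin := H10_lincomb oOm bOm.
Let XH v : H10 Om v -> X v := @DGsum_H10 _ _ Om K sh F p v.
Let XS v (hv : S v) : X v := DGsum_DGspace oOm bOm hv Hu.
Let XD v z : X v -> X z -> X (v \+ z).
Proof. by move=> *; rewrite lincombD1; exact: Xlin. Qed.
Let XB v z : X v -> X z -> X (v \- z).
Proof. by move=> *; rewrite lincombB1; exact: Xlin. Qed.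
Let HB v z : H10 Om v -> H10 Om z -> H10 Om (v \- z).
Proof. by move=> *; rewrite lincombB1; exact: Hlin. Qed.

Lemma form_le_norms v z : H10 Om v -> H10 Om z -> `|b v z| <= nrm v * nrm z.
Proof.
have [_ bl _] := hb; have [n0 _ _ _] := hn.
move=> hv hz; have := @form_Cauchy_Schwarz _ _ (H10 Om) b v z Hlin bC.
rewrite (b_nrm hv) (b_nrm hz) !sqrtr_sqr.
rewrite (ger0_norm (n0 _ (XH hv))) (ger0_norm (n0 _ (XH hz))).
apply=> //; first by move=> y hy; rewrite b_nrm// sqr_ge0.
by move=> k v1 v2 z1 h1 h2 h3; apply: bl; exact: XH.
Qed.

(** The residual dU + AU - PF belongs to S and is orthogonal to S; tested with itself it vanishes
    almost everywhere. The scheme thereby extends from discrete test functions to all of [H10]. *)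
Lemma reconstruction_residual v : H10 Om v -> b w v = inner Om f v - inner Om dU v.
Proof.
move=> hv; have [Lv _] := hv; rewrite recon//.
have [LdU _] := SdU; have [LAU _] := SAU; have [LPF _] := SPF.
pose r := (dU \+ AU) \- PF.
have Sr : S r by rewrite /r lincombB1 (lincombD1 dU); do 2 apply: DGspace_lincomb => //.
have r0 : ae_eq_on Om r (fun=> 0).
  apply: inner_eq0 => //; first by case: Sr.
  have [Lr _] := Sr.
  rewrite {1}/r innerBl//; last exact: L2D.
  by rewrite innerDl// PFE// AUE// scheme// subrr.
rewrite -innerBl//; apply: ae_eq_inner => //.
- by apply: L2D => //; exact: L2B.
- exact: L2B.
- apply: filterS r0 => x + Omx => /(_ Omx); rewrite /r /= => /eqP.
  by rewrite subr_eq0 => /eqP <-; ring.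
- by apply: aeW.
Qed.

(** The factor 1 / sqrt(al) in the dual norm is repaid by sqrt(al) ||grad v|| <= nrm v. Functions
    vanishing almost everywhere are outside the supremum and are treated apart. *)
Lemma Hm1norm_bound v : H10 Om v ->
  Hm1norm Om (fun x => dUd x / Num.sqrt al) \is a fin_num ->
  - inner Om dUd v <= `|fine (Hm1norm Om (fun x => dUd x / Num.sqrt al))| * nrm v.
Proof.
move=> hv; set H := Hm1norm _ _ => Hfin.
have [n0 nE nZ _] := hn; have [Lv _] := hv.
have sal : 0 < Num.sqrt al by rewrite sqrtr_gt0.
have nv0 : 0 <= nrm v by exact/n0/XH.
have [v0|v0] := pselect (ae_eq_on Om v (fun=> 0)).
  suff -> : inner Om dUd v = 0 by rewrite oppr0 mulr_ge0.
  rewrite (ae_eq_inner (v' := dUd) (z' := fun=> 0) oOm)//.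
  - by rewrite /inner; under eq_Rintegral do rewrite mulr0; rewrite Rintegral_cst// ?mul0r//; exact: measurable_open.
  - exact: L2_0.
  - exact: aeW.
(* Testing with v' = - v avoids grad (- v) = - grad v, which is not available. *)
pose v' : E -> R := (-1) \*o v.
have v'E : v' = (-2) \*o v \+ v by apply/funext => x; rewrite /v' /=; ring.
have hv' : H10 Om v' by rewrite v'E; exact: Hlin.
have nv' : nrm v' = nrm v by rewrite nZ ?normrN1 ?mul1r//; exact: XH.
have v'0 : ~ ae_eq_on Om v' (fun=> 0).
  apply: contra_not v0; apply: filterS => x + Omx => /(_ Omx) /eqP.
  by rewrite /v' /= mulN1r oppr_eq0 => /eqP.
(* A zero denominator would force nrm v' = 0 by the upper bound in [coer], hence v' = 0 almost
   everywhere. *)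
have G0 : 0 < L2vnorm Om (grad Om v').
  rewrite lt_def sqrtr_ge0 andbT; apply: contra_not_neq v'0 => G0.
  apply/nE; first exact: XH.
  have /andP[_] := coer hv'; rewrite G0 expr0n mulr0 => n2.
  by apply/eqP; rewrite -sqrf_eq0 eq_le n2 sqr_ge0.
have le : (((inner Om (fun x => dUd x / Num.sqrt al) v') / L2vnorm Om (grad Om v'))%:E <= H)%E.
  by apply: ereal_sup_ubound; exists v'.
move: le; rewrite -(fineK Hfin) lee_fin ler_pdivrMr// => le.
have innE : inner Om (fun x => dUd x / Num.sqrt al) v' = (Num.sqrt al)^-1 * (- inner Om dUd v).
  have := inner_lincombl oOm (-2) Lv Lv LdUd.
  rewrite -v'E (innerC _ v) => v'd.
  rewrite (_ : (fun x => _) = ((Num.sqrt al)^-1 - 1) \*o dUd \+ dUd); last first.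
    by apply/funext => x /=; ring.
  rewrite inner_lincombl//; last by case: hv'.
  by rewrite (innerC _ dUd v') v'd; ring.
rewrite innE ler_pdivrMl// in le.
apply: (le_trans le).
have alG : Num.sqrt al * L2vnorm Om (grad Om v') <= nrm v.
  rewrite -nv' -[leRHS]ger0_norm ?nv'// -[X in _ <= `|X|]nv' -sqrtr_sqr.
  rewrite -[leLHS]ger0_norm ?mulr_ge0 ?sqrtr_ge0// -sqrtr_sqr ler_wsqrtr//.
  by rewrite exprMn sqr_sqrtr ?(ltW al0)//; have /andP[] := coer hv'.
rewrite mulrCA; apply: (@le_trans _ _ (`|fine H| * (Num.sqrt al * L2vnorm Om (grad Om v')))).
  by rewrite ler_wpM2r ?ler_norm// mulr_ge0 ?sqrtr_ge0.
by rewrite ler_wpM2l.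
Qed.

(** The test function is Uc - u, which lies in [H10]; inside the inner product it is rewritten as U
    - Ud - u, equal to it almost everywhere, to match the time derivative dU - dUd - du. *)
Lemma error_inequality :
  Hm1norm Om (fun x => dUd x / Num.sqrt al) \is a fin_num ->
  exists2 e : R, nrm (U \- u) <= nrm Ud + e &
    e ^+ 2 <= - inner Om (dU \- dUd \- du) (U \- Ud \- u) +
      (`|fine (Hm1norm Om (fun x => dUd x / Num.sqrt al))| + nrm (w \- U) + nrm Ud) * e.
Proof.
move=> Hfin; have [n0 nE nZ ntri] := hn; have [_ bl _] := hb.
pose e0 := Uc \- u; have he0 : H10 Om e0 by exact: HB.
pose r := w \- Uc; have hr : H10 Om r by exact: HB.
have [LU _] := SU; have [LUd _] := SUd; have [LdU _] := SdU.
have [Le0 _] := he0; have [Lu _] := Hu.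
exists (nrm e0).
  rewrite (norm_on_ae_eq (z := Ud \+ e0) Xlin hn); first exact: ntri (XS SUd) (XH he0).
  - by apply: XB; [exact: XS|exact: XH].
  - by apply: XD; [exact: XS|exact: XH].
  - by apply: filterS UE => x + Omx => /(_ Omx) /= ->; rewrite /e0 /=; ring.
have rle : nrm r <= nrm (w \- U) + nrm Ud.
  have XwU : X (w \- U) by apply: XB; [exact: XH|exact: XS].
  rewrite (norm_on_ae_eq (z := (w \- U) \+ Ud) Xlin hn); first exact: ntri XwU (XS SUd).
  - exact: XH.
  - by apply: XD => //; exact: XS.
  - by apply: filterS UE => x + Omx => /(_ Omx) /= ->; rewrite /r /=; ring.
(* This splits b w e0 into the consistency term b r e0, the energy of e0 and b u e0, which the weak
   form cancels. *)
have wE : w = 1 \*o r \+ (1 \*o e0 \+ u).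
  by apply/funext => x; rewrite /r /e0 /=; ring.
have := reconstruction_residual he0.
rewrite [in b w e0]wE bl; [|exact: XH|by apply: XH; apply: Hlin|exact: XH].
rewrite bl; [|exact: XH|exact: XH|exact: XH].
rewrite !mul1r (b_nrm he0) => E1.
have E2 := weak he0.
have E3 := form_le_norms hr he0.
have E4 := Hm1norm_bound he0 Hfin.
have E5 : inner Om (dU \- dUd \- du) (U \- Ud \- u) =
    inner Om dU e0 - inner Om dUd e0 - inner Om du e0.
  rewrite -!innerBl//; last exact: L2B.
  apply: ae_eq_inner => //; try by do ?apply: L2B.
  - exact: aeW.
  - by apply: filterS UE => x + Omx => /(_ Omx) /= ->; rewrite /e0 /=; ring.
rewrite E5; have := ler_norm (- b r e0); rewrite normrN => E6.
have nen : 0 <= nrm e0 by exact/n0/XH.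
have : nrm r * nrm e0 <= (nrm (w \- U) + nrm Ud) * nrm e0 by rewrite ler_wpM2r.
set h := `|fine _| in E4 *; move=> E7; rewrite !mulrDl in E7 *; lra.
Qed.

End fixed_time.

(** * Differences of weak derivatives and the final estimate *)

Section time_derivatives.
Context {R : realType} {d : nat}.
Variables (Om : set 'rV[R]_d) (T : R).
Hypotheses (oOm : open Om) (T0 : 0 < T).
Local Notation E := 'rV[R]_d.
Local Notation lam := (@lebesgue_measure R).
Local Notation I0T := (`[0, T]%classic : set (measurableTypeR R)).
Implicit Types v g : R -> E -> R.

Lemma time_continuousB v v' (t : R) :
  (forall t : R, t \in `[0, T] -> L2 Om (v t)) ->
  (forall t : R, t \in `[0, T] -> L2 Om (v' t)) -> t \in `[0, T] ->
  time_continuous_at T (L2norm Om) v t -> time_continuous_at T (L2norm Om) v' t ->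
  time_continuous_at T (L2norm Om) (fun t => v t \- v' t) t.
Proof.
move=> Lv Lv' tT cv cv' e e0; have e2 : 0 < e / 2 by rewrite divr_gt0.
have [d1 d10 h1] := cv _ e2; have [d2 d20 h2] := cv' _ e2.
exists (Num.min d1 d2); first by rewrite lt_min d10 d20.
move=> s sT; rewrite lt_min => /andP[s1 s2].
have -> : (v s \- v' s) \- (v t \- v' t) = (-1) \*o (v' s \- v' t) \+ (v s \- v t).
  by apply/funext => x /=; ring.
have L1 : L2 Om (v' s \- v' t) by apply: L2B => //; exact: Lv'.
have L3 : L2 Om (v s \- v t) by apply: L2B => //; exact: Lv.
apply: le_lt_trans (L2norm_lincomb oOm (-1) L1 L3) _.
by rewrite normrN1 mul1r (splitr e) addrC ltrD// ?h1 ?h2.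
Qed.

(** The defining identities subtract once the integrals can be split: those with th' are integrable
    by continuity in time, those with th because th is bounded on [0, T]. *)
Lemma time_derivativeB v v' g g' :
  (forall t : R, t \in `[0, T] -> L2 Om (v t)) ->
  (forall t : R, t \in `[0, T] -> L2 Om (v' t)) ->
  (forall t : R, t \in `[0, T] -> time_continuous_at T (L2norm Om) v t) ->
  (forall t : R, t \in `[0, T] -> time_continuous_at T (L2norm Om) v' t) ->
  time_derivative Om T v g -> time_derivative Om T v' g' ->
  time_derivative Om T (fun t => v t \- v' t) (fun t => g t \- g' t).
Proof.
move=> Lv Lv' cv cv' [Lg vg] [Lg' vg'].
have Lgt (t : R) : t \in `[0, T] -> L2 Om (g t) by case: Lg => + _ _; exact.
have Lgt' (t : R) : t \in `[0, T] -> L2 Om (g' t) by case: Lg' => + _ _; exact.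
split.
  rewrite (_ : (fun t => _) = (fun t => (-1) \*o g' t \+ g t)); first exact: L2L2_lincomb.
  by apply/funext => t; rewrite lincombB1.
move=> th z tth Lz; have [dth cth _] := tth.
have mI : measurable I0T by exact: measurable_itv.
have Iv y : (forall t : R, t \in `[0, T] -> L2 Om (y t)) ->
    (forall t : R, t \in `[0, T] -> time_continuous_at T (L2norm Om) y t) ->
    lam.-integrable `[0, T] (EFin \o (fun t => inner Om (y t) z * derive1 th t)).
  move=> Ly cy.
  have c1 : {within `[0, T], continuous (fun t => inner Om (y t) z)}.
    by apply: (continuous_on_within T0) => s sT; exact: continuous_on_inner.
  have c2 : {within `[0, T], continuous (derive1 th)}.
    by apply: continuous_subspaceT => s; exact: cth.
  by apply: continuous_itv_integrable => t; exact: continuousM (c1 t) (c2 t).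
have cth0 : continuous th.
  by move=> t; apply: differentiable_continuous; exact/derivable1_diffP.
have [s _ sM] : exists2 s : R, s \in `[0, T] & forall t : R, t \in `[0, T] -> `|th t| <= `|th s|.
  apply: (@EVT_max R (fun t => `|th t|)); first exact: ltW.
  apply: continuous_subspaceT => t; apply: continuous_comp; first exact: cth0.
  exact: norm_continuous.
have Ig y : L2L2 Om T y ->
    lam.-integrable `[0, T] (EFin \o (fun t => inner Om (y t) z * th t)).
  move=> Ly; have Iy := integrable_inner oOm Ly Lz.
  apply: (@le_integrable_EFin _ _ _ lam _ mI _ (fun t => `|th s| * `|inner Om (y t) z|)).
  - apply: measurable_funM.
      by apply/measurable_EFinP; exact: measurable_int Iy.
    by apply: measurable_funTS; exact: continuous_measurable_fun.
  - by apply: integrable_EFinZl => //; exact: integrable_EFin_normr.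
  - by move=> t tT; rewrite normrM mulrC ler_wpM2r// sM.
transitivity (\int[lam]_(t in `[0, T]) (inner Om (v t) z * derive1 th t) -
    \int[lam]_(t in `[0, T]) (inner Om (v' t) z * derive1 th t)).
  rewrite -RintegralB//; [|exact: Iv|exact: Iv].
  apply: eq_Rintegral => t /set_mem tT.
  by rewrite innerBl ?mulrBl//; [exact: Lv|exact: Lv'].
rewrite vg// vg'// opprK addrC -opprB; congr (- _).
rewrite -RintegralB//; [|exact: Ig|exact: Ig].
apply: eq_Rintegral => t /set_mem tT.
by rewrite innerBl ?mulrBl//; [exact: Lgt|exact: Lgt'].
Qed.

End time_derivatives.

Lemma ref_element_nonempty {R : realType} {d : nat} (b : bool) :
  @ref_element R d b !=set0.
Proof.
case: b; last by exists (const_mx 2^-1) => i; rewrite mxE; apply/andP; split; lra.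
(* The barycentre of the simplex; its coordinates sum to d / (d + 1). *)
exists (const_mx d.+1%:R^-1); split=> [i|]; first by rewrite mxE.
under eq_bigr do rewrite mxE.
rewrite sumr_const card_ord -[_ *+ d]mulr_natr mulrC ltr_pdivrMr// mul1r ltr_nat//.
Qed.

Theorem theorem3p6 (R : realType) (d : nat) (d23 : d = 2%N \/ d = 3%N)
  (Om : set 'rV[R]_d) (T : R)
  (Om_dom : curvilinear_polygonal_domain Om) (T_gt0 : 0 < T)
  (K : finType) (kap : K -> set 'rV[R]_d) (sh : K -> bool)
  (F : K -> 'rV[R]_d -> 'rV[R]_d) (p : nat)
  (mesh : subdivision Om kap sh F) (p_ge1 : (1 <= p)%N)
  (a : R -> 'rV[R]_d -> 'M[R]_d) (f : R -> 'rV[R]_d -> R)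
  (ha : diffusion_coefficient Om T kap a) (hf : source_term Om T f)
  (u0 : 'rV[R]_d -> R) (u du : R -> 'rV[R]_d -> R)
  (hu : weak_solution Om T a f u0 u du)
  (B : R -> ('rV[R]_d -> R) -> ('rV[R]_d -> R) -> R)
  (N : R -> ('rV[R]_d -> R) -> R)
  (hB : forall t : R, t \in `[0, T] -> bilinear_form_on Om (DGsum Om sh F p) (B t))
  (hN : forall t : R, t \in `[0, T] -> norm_on Om (DGsum Om sh F p) (N t))
  (B_conf : forall (t : R) v z, t \in `[0, T] -> H10 Om v -> H10 Om z ->
     B t v z = stiffness Om (a t) v z)
  (N_conf : forall (t : R) v, t \in `[0, T] -> H10 Om v ->
     N t v = energy_norm Om (a t) v)
  (U dU : R -> 'rV[R]_d -> R)
  (hU : semidiscrete_solution Om T (DGspace Om sh F p) B f U dU)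
  (P : ('rV[R]_d -> R) -> 'rV[R]_d -> R)
  (A : R -> ('rV[R]_d -> R) -> 'rV[R]_d -> R) (w : R -> 'rV[R]_d -> R)
  (hP : is_L2_projection Om sh F p P)
  (hA : forall t : R, t \in `[0, T] -> is_discrete_operator Om sh F p (B t) (A t))
  (hw : elliptic_reconstruction Om T B P A f U w)
  (Uc Ud dUd : R -> 'rV[R]_d -> R)
  (hUcd : forall t : R, t \in `[0, T] ->
     [/\ ae_eq_on Om (U t) (Uc t \+ Ud t),
         DGspace Om sh F p (Uc t) /\ H10 Om (Uc t), DGspace Om sh F p (Ud t) &
         time_continuous_at T (L2norm Om) Ud t])
  (hdUd : time_derivative Om T Ud dUd)
  (mUu : time_measurable T (fun t => (N t (U t \- u t)%R)%:E))
  (mwU : time_measurable T (fun t => (N t (w t \- U t)%R)%:E))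
  (mUd : time_measurable T (fun t => (N t (Ud t))%:E))
  (mdUd : time_measurable T (fun t =>
     Hm1norm Om (fun x => (dUd t x / Num.sqrt (alpha_flat kap (a t)))%R))) :
  (L2time T (fun t => (N t (U t \- u t)%R)%:E) <=
   3%:E * L2time T (fun t => (N t (w t \- U t)%R)%:E) +
   2%:E * L2time T (fun t => (N t (Ud t))%:E) +
   2%:E * L2time T (fun t =>
     Hm1norm Om (fun x => (dUd t x / Num.sqrt (alpha_flat kap (a t)))%R)) +
   2%:E * (L2norm Om (u0 \- Uc 0)%R)%:E)%E.
Proof.
have d0 : (0 < d)%N by case: d23 => ->.
have [oOm _ Om0 bOm _] := Om_dom.
have [kapOm _ cover kapF] := mesh.
have kapO k : open (kap k) by have [] := kapF k.
have kap0 k : kap k !=set0.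
  have [_ _ <- _ _] := kapF k; have [x xr] := @ref_element_nonempty R d (sh k).
  by exists (F k x), x.
have [ma _ apos [c [C [c0 acC]]] _] := ha.
have [Lf _ _ _] := hf.
have [uH10 du_u weak_u u_u0] := hu.
have [US [L ULip] dU_U scheme] := hU.
have mOm : measurable Om := measurable_open oOm.
have LU (t : R) : t \in `[0, T] -> L2 Om (U t) by move=> /US[[]].
have Lu (t : R) : t \in `[0, T] -> L2 Om (u t) by move=> /uH10[[]].
have LUd (t : R) : t \in `[0, T] -> L2 Om (Ud t) by move=> /hUcd[_ _ []].
have cU (t : R) : t \in `[0, T] -> time_continuous_at T (L2norm Om) U t.
  move=> tT eps eps0; have L1 : 0 < `|L| + 1 by rewrite ltr_wpDl.
  exists (eps / (`|L| + 1)) => [|s sT]; first by rewrite divr_gt0.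
  rewrite ltr_pdivlMr// => st; apply: le_lt_trans (ULip s t sT tT) _.
  apply: le_lt_trans st; rewrite mulrC ler_wpM2l//.
  by rewrite (le_trans (ler_norm L))// lerDl.
have cu (t : R) : t \in `[0, T] -> time_continuous_at T (L2norm Om) u t.
  move=> tT eps eps0; have [_ cut] := uH10 t tT; have [del del0 H] := cut _ eps0.
  exists del => // s sT st; apply: le_lt_trans (H s sT st).
  rewrite /H1norm -[leLHS]ger0_norm ?sqrtr_ge0// -sqrtr_sqr ler_wsqrtr//.
  by rewrite lerDl sqr_ge0.
have cUd (t : R) : t \in `[0, T] -> time_continuous_at T (L2norm Om) Ud t.
  by move=> /hUcd[].
(* A representative of Uc - u built from functions with known time derivatives and
   L_2-continuity. *)
pose UU t := U t \- Ud t; pose e t := UU t \- u t.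
pose g t := (dU t \- dUd t) \- du t.
have LUU (t : R) : t \in `[0, T] -> L2 Om (UU t) by move=> tT; apply: L2B; [|exact: LU|exact: LUd].
have Le (t : R) : t \in `[0, T] -> L2 Om (e t) by move=> tT; apply: L2B; [|exact: LUU|exact: Lu].
have cUU (t : R) : t \in `[0, T] -> time_continuous_at T (L2norm Om) UU t.
  by move=> tT; apply: time_continuousB => //; [exact: cU|exact: cUd].
have ce (t : R) : t \in `[0, T] -> time_continuous_at T (L2norm Om) e t.
  by move=> tT; apply: time_continuousB => //; [exact: cUU|exact: cu].
have eg : time_derivative Om T e g.
  have d1 := @time_derivativeB R d Om T oOm T_gt0 U Ud dU dUd LU LUd cU cUd dU_U hdUd.
  exact: (@time_derivativeB R d Om T oOm T_gt0 UU u _ du LUU Lu cUU cu d1 du_u).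
have [Iq qE] := energy_identity oOm T_gt0 Le ce eg.
(* At t = 0 the functions U - Ud - u and Uc - u0 agree almost everywhere, and squaring absorbs the
   opposite sign. *)
have c0E : L2norm Om (u0 \- Uc 0) = Num.sqrt (inner Om (e 0) (e 0)).
  have T00 : (0 : R) \in `[0, T] by rewrite in_itv/= lexx ltW.
  have [UE _ _ _] := hUcd 0 T00.
  rewrite /L2norm; congr Num.sqrt; congr fine.
  apply: ge0_ae_eq_integral => [x _|x _|]; rewrite ?lee_fin -?expr2 ?sqr_ge0//.
  apply: filterS2 UE u_u0 => x + + Omx => /(_ Omx) /= UE /(_ Omx) uE.
  by rewrite /e /UU /= UE uE; congr EFin; ring.
rewrite c0E.
have XS (t : R) (tT : t \in `[0, T]) v (hv : DGspace Om sh F p v) : DGsum Om sh F p v.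
  by have [hut _] := uH10 t tT; exact: DGsum_DGspace hv hut.
have XB v z := @DGsum_lincomb R d Om K sh F p oOm bOm (-1) v z.
apply: (@L2time_estimate R T _ _ _ (fun t => inner Om (g t) (e t)) _ _ (inner Om (e T) (e T))) => //.
- exact/measurable_EFinP.
- exact/measurable_EFinP.
- exact/measurable_EFinP.
- move=> t tT; have [n0 _ _ _] := hN t tT; have [US1 _] := US t tT.
  have [_ _ SUd _] := hUcd t tT; have [hut _] := uH10 t tT.
  split; apply: n0; last exact: XS tT _ SUd.
  by rewrite lincombB1; apply: XB; [exact: DGsum_H10|exact: XS tT _ US1].
- exact: inner_ge0.
- exact: inner_ge0.
(* Positivity and ellipticity are given almost everywhere in space-time; the form at one time needs
   them on almost all of its slice. *)
have good : {ae lebesgue_measure, forall t : R, t \in `[0, T] ->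
    {ae @lebesgue_rV R d, forall x, Om x -> symposdef (a t x) /\
      forall z, c * dotv z z <= dotv (a t x *m z) z <= C * dotv z z}}.
  have ap : {ae (@lebesgue_measure R \x @lebesgue_rV R d)%E, forall q, spacetime Om T q ->
      symposdef (a q.1 q.2) /\
      forall z, c * dotv z z <= dotv (a q.1 q.2 *m z) z <= C * dotv z z}.
    by apply: filterS2 apos acC => q + + sq => /(_ sq) ? /(_ sq).
  apply: filterS (ae_xsection ap) => t ht tT.
  by apply: filterS ht => x + Omx => /=; apply.
apply: ae_time2 good weak_u => t tT goodt weakt Hfin.
have mat i j : measurable_fun Om (fun x => a t x i j).
  apply: (measurable_comp (f := fun q => a q.1 q.2 i j) (g := fun x => (t, x)) (F := spacetime Om T)) => //.
  - by apply: measurableX => //; exact: measurable_itv.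
  - by move=> _ [x Omx <-].
  - by apply: measurable_funTS; exact: measurable_pair1.
have goodc : {ae @lebesgue_rV R d, forall x, Om x -> symposdef (a t x) /\
      forall z, c * dotv z z <= dotv (a t x *m z) z}.
  apply: filterS goodt => x + Omx => /(_ Omx)[pa ca]; split=> // z.
  by have /andP[] := ca z.
have al0 := alpha_flat_gt0 d0 oOm Om0 kapO kap0 kapOm cover c0 goodc.
have al_ae := alpha_flat_ae d0 kapO kap0 kapOm cover c0 goodc.
have [US1 dUS] := US t tT; have [hut _] := uH10 t tT; have [hwt recon] := hw t tT.
have [UE [UcS hUc] SUd _] := hUcd t tT.
have [SPF PFE] := hP _ (Lf t tT); have [SAU AUE] := hA t tT _ US1.
have bC v z : H10 Om v -> H10 Om z -> B t v z = B t z v.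
  move=> hv hz; rewrite (B_conf t v z tT hv hz) (B_conf t z v tT hz hv).
  exact: (stiffnessC oOm mat goodt hv hz).
have b_nrm v : H10 Om v -> B t v v = N t v ^+ 2.
  move=> hv; rewrite (B_conf t v v tT hv hv) (N_conf t v tT hv).
  by rewrite (sqr_energy_norm d0 oOm mat goodt hv).
have coer v : H10 Om v ->
    alpha_flat kap (a t) * L2vnorm Om (grad Om v) ^+ 2 <= N t v ^+ 2 <=
    `|C| * L2vnorm Om (grad Om v) ^+ 2.
  move=> hv; rewrite (N_conf t v tT hv).
  exact: (energy_norm_bounds d0 oOm goodt (ltW al0) al_ae hv).
have Ldu : L2 Om (du t) by have [[Ldu _ _] _] := du_u; exact: Ldu.
have LdUd : L2 Om (dUd t) by have [[LdUd _ _] _] := hdUd; exact: LdUd.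
have weak' v : H10 Om v -> inner Om (du t) v + B t (u t) v = inner Om (f t) v.
  by move=> hv; rewrite (B_conf t (u t) v tT hut hv); exact: weakt.
exact: (error_inequality oOm bOm (hB t tT) (hN t tT) bC b_nrm al0 coer (Lf t tT)
  US1 dUS hut Ldu hwt hUc SUd LdUd UE SPF PFE SAU AUE (scheme t tT) recon weak' Hfin).
Qed.
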